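(* Let $\mathcal{A}$ be a finite-dimensional weak Hopf algebra over $\mathbb{C}$ such that $\mathcal{A}^*$ is semisimple and pivotal, let $k\in\mathcal{A}^*$ be a pivotal element of $\mathcal{A}^*$ and $\xi_a\in\mathbb{C}$ scalars with $\psi_a(k)=\xi_a\psi_a(g)$ for all $a$. Define $\Omega\in\mathcal{A}$ by $$f(\Omega)=\sum_{a\in\mathrm{Irr}(\mathcal{A}^* )}\frac{1}{\sum_{x:\,l_x=l_a}d_x^2}\cdot\frac{d_a}{\xi_a}\,\mathrm{Tr}\,\psi_a(f)\qquad(f\in\mathcal{A}^* ).$$ Then $\Omega$ is non-degenerate and cocommutative ($\Delta_{\mathrm{op}}(\Omega)=\Delta(\Omega)$), $\Omega^2=\Omega$, and there exists a linear map $T:\mathcal{A}\to\mathcal{A}$ such that for all $x\in\mathcal{A}$, $(1\otimes x)\Delta(\Omega)=(T(x)\otimes1)\Delta(\Omega)$ and $$\Delta(T(x))=\sum k^{-1}(x_{(2)})\,T(x_{(3)})\otimes T(x_{(1)}),$$ i.e. $\Delta\circ T=(T\otimes k^{-1}\otimes T)\circ\Delta^2_{\mathrm{op}}$.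
   Context: Weak Hopf algebra: a finite-dimensional unital algebra $\mathcal{A}$ with coassociative counital coproduct $\Delta$ (Sweedler notation), counit $\epsilon$, $\Delta(xy)=\Delta(x)\Delta(y)$, $\Delta^2(1)=(1\otimes\Delta(1))(\Delta(1)\otimes1)=(\Delta(1)\otimes1)(1\otimes\Delta(1))$, $\epsilon(xyz)=\sum\epsilon(xy_{(1)})\epsilon(y_{(2)}z)=\sum\epsilon(xy_{(2)})\epsilon(y_{(1)}z)$, and antipode $S$ with $\sum S(x_{(1)})x_{(2)}=\sum 1_{(1)}\epsilon(x1_{(2)})$, $\sum x_{(1)}S(x_{(2)})=\sum\epsilon(1_{(1)}x)1_{(2)}$, $\sum S(x_{(1)})x_{(2)}S(x_{(3)})=S(x)$. $\Delta_{\mathrm{op}}(x)=\sum x_{(2)}\otimes x_{(1)}$, $\Delta^2_{\mathrm{op}}(x)=\sum x_{(3)}\otimes x_{(2)}\otimes x_{(1)}$. The dual $\mathcal{A}^*$ is a weak Hopf algebra with product $(fg)(x)=\sum f(x_{(1)})g(x_{(2)})$, unit $\epsilon$, coproduct $\Delta(f)(x\otimes y)=f(xy)$, antipode $S(f)=f\circ S$. An element $k\in\mathcal{A}^*$ is group-like if it is invertible and $\Delta(k)=(k\otimes k)\Delta(\epsilon)=\Delta(\epsilon)(k\otimes k)$; it is a pivotal element of $\mathcal{A}^*$ if it is group-like and $S^2(f)=kfk^{-1}$ for all $f\in\mathcal{A}^*$; $\mathcal{A}^*$ is pivotal if such $k$ exists. An element $x\in\mathcal{A}$ is non-degenerate if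 $\{(f\otimes\mathrm{Id})\Delta(x)\}=\{(\mathrm{Id}\otimes f)\Delta(x)\}=\mathcal{A}$ ($f$ ranging over $\mathcal{A}^*$). For $a\in\mathrm{Irr}(\mathcal{A}^* )$ fix irreps $\psi_a:\mathcal{A}^*\to\mathrm{End}(W_a)$. $N_{ab}^c$ = multiplicity of $\psi_c$ in $f\mapsto(\psi_a\otimes\psi_b)(\Delta f)$ restricted to the range of $(\psi_a\otimes\psi_b)(\Delta\epsilon)$; fusion tensors $V^{c\mu}_{ab}:W_c\to W_a\otimes W_b$, $W^{c\mu}_{ab}:W_a\otimes W_b\to W_c$ with $(\psi_a\otimes\psi_b)(\Delta f)=\sum_{c,\mu}V^{c\mu}_{ab}\psi_c(f)W^{c\mu}_{ab}$, $W^{c\mu}_{ab}V^{d\nu}_{ab}=\delta_{cd}\delta_{\mu\nu}\mathrm{id}$. Vacuum: $b_a\in\mathrm{End}(W_a)$ with $f(1)=\sum_a\mathrm{Tr}(b_a\psi_a(f))$, $E=\{a:b_a\ne0\}$; $b_e=v_eu_e$ rank one; for each $a$ unique $l_a,r_a\in E$ with $N_{ea}^b=\delta_{e,l_a}\delta_{ab}$, $N_{ae}^b=\delta_{e,r_a}\delta_{ab}$ ($e\in E$). Conjugation: $\bar a$ is the class of $f\mapsto\psi_a(Sf)^T$ on $W_a^*$; invertible $Z_a:W_{\bar a}\to W_a^*$ with $\psi_a(Sf)^T=Z_a\psi_{\bar a}(f)Z_a^{-1}$. With $\zeta_c(\xi\otimes\eta)=(Z_c\xi)(\eta)$ on $W_{\bar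 c}\otimes W_c$ and $\theta_c\in W_{\bar c}\otimes W_c$ given by $(\varphi\otimes\mathrm{id})\theta_c=Z_{\bar c}^{-1}(\varphi)$, $w_c\ne0$ is defined by $\zeta_c\otimes\theta_c=w_c(u_{r_c}\circ W^{r_c}_{\bar cc})\otimes(V^{r_c}_{\bar cc}v_{r_c})$. $d_a\in\mathbb{C}$ satisfy $d_a^2=w_aw_{\bar a}$, $d_a=d_{\bar a}$; $g\in\mathcal{A}^*$ is defined by $\psi_a(g)=\frac{d_a}{w_{\bar a}}(Z_a^{-1})^TZ_{\bar a}$ (it implements $S^2$: $\psi_a(S^2f)=\psi_a(g)\psi_a(f)\psi_a(g)^{-1}$). *)

(* Defs.v *)
(* Finite-dimensional weak Hopf algebras over a field C,
   presented concretely in coordinates: A = C^n (row vectors 'rV_n, basis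
   e_i = delta_mx 0 i), A (x) A = 'M_n (entry (i,j) = coefficient of
   e_i (x) e_j), A (x) A (x) A = functions 'I_n -> 'I_n -> 'I_n -> C.
   The dual A^* is also represented by 'rV_n, with f(x) = \sum_i f_i x_i,
   so that delta_mx 0 i is the dual basis. *)
From HB Require Import structures.
From mathcomp Require Import all_boot all_order all_algebra.
From mathcomp Require Import mxtens.

Set Implicit Arguments.
Unset Strict Implicit.
Unset Printing Implicit Defensive.
Import GRing.Theory.
Local Open Scope ring_scope.

Section WeakHopf.
Variables (C : fieldType) (n : nat).
Local Notation V := 'rV[C]_n.
Local Notation V2 := 'M[C]_n.
Definition T3 := 'I_n -> 'I_n -> 'I_n -> C.

Definition bvec (i : 'I_n) : V := delta_mx 0 i.
Definition ev (f x : V) : C := \sum_i f 0 i * x 0 i.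
Definition tens (x y : V) : V2 := x^T *m y.

Definition mulA (m : 'I_n -> 'I_n -> V) (x y : V) : V :=
  \sum_i \sum_j (x 0 i * y 0 j) *: m i j.
Definition mul2 (m : 'I_n -> 'I_n -> V) (u v : V2) : V2 :=
  \sum_i \sum_j \sum_k \sum_l (u i j * v k l) *: tens (m i k) (m j l).
Definition mul3 (m : 'I_n -> 'I_n -> V) (u v : T3) : T3 :=
  fun a b c => \sum_i1 \sum_i2 \sum_i3 \sum_j1 \sum_j2 \sum_j3
    u i1 i2 i3 * v j1 j2 j3 * (m i1 j1 0 a * m i2 j2 0 b * m i3 j3 0 c).

Record wha := WHA {
  wmul : 'I_n -> 'I_n -> V;
  wone : V;
  wcop : 'I_n -> V2;
  weps : V;                   (* counit: epsilon(x) = ev weps x *)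
  wS   : 'M[C]_n              (* antipode: S(x) = x *m wS *)
}.

Variable H : wha.

Definition mulH := mulA (wmul H).
Definition Delta (x : V) : V2 := \sum_i x 0 i *: wcop H i.
Definition epsH (x : V) : C := ev (weps H) x.
Definition SH (x : V) : V := x *m wS H.
Definition Delta2 (x : V) : T3 :=
  fun a b c => \sum_j Delta x j c * wcop H j a b.
Definition Delta1_x_1 : T3 := fun a b c => Delta (wone H) a b * wone H 0 c.
Definition one_x_Delta1 : T3 := fun a b c => wone H 0 a * Delta (wone H) b c.

Definition is_wha : Prop :=
  [/\ (forall x y z, mulH (mulH x y) z = mulH x (mulH y z)),
      (forall x, mulH (wone H) x = x /\ mulH x (wone H) = x),
      (forall x a b c, \sum_j Delta x j c * wcop H j a b
                      = \sum_j Delta x a j * wcop H j b c),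
      (forall x, \sum_i \sum_j (Delta x i j * epsH (bvec i)) *: bvec j = x
              /\ \sum_i \sum_j (Delta x i j * epsH (bvec j)) *: bvec i = x) &
      (forall x y, Delta (mulH x y) = mul2 (wmul H) (Delta x) (Delta y))] /\
   [/\
      (forall a b c, Delta2 (wone H) a b c
                     = mul3 (wmul H) one_x_Delta1 Delta1_x_1 a b c
                  /\ Delta2 (wone H) a b c
                     = mul3 (wmul H) Delta1_x_1 one_x_Delta1 a b c),
      (forall x y z,
         epsH (mulH (mulH x y) z)
           = \sum_i \sum_j Delta y i j * epsH (mulH x (bvec i))
                                        * epsH (mulH (bvec j) z)
      /\ epsH (mulH (mulH x y) z)
           = \sum_i \sum_j Delta y i j * epsH (mulH x (bvec j))
                                        * epsH (mulH (bvec i) z)),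
      (forall x, \sum_i \sum_j Delta x i j *: mulH (SH (bvec i)) (bvec j)
               = \sum_i \sum_j (Delta (wone H) i j
                                  * epsH (mulH x (bvec j))) *: bvec i),
      (forall x, \sum_i \sum_j Delta x i j *: mulH (bvec i) (SH (bvec j))
               = \sum_i \sum_j (epsH (mulH (bvec i) x)
                                  * Delta (wone H) i j) *: bvec j) &
      (forall x, \sum_a \sum_b \sum_c Delta2 x a b c
                   *: mulH (mulH (SH (bvec a)) (bvec b)) (SH (bvec c))
               = SH x)].

(* product: (f g)(x) = sum f(x_(1)) g(x_(2)); structure constants *)
Definition dmul (i j : 'I_n) : V := \row_l wcop H l i j.
Definition dmulH := mulA dmul.
Definition dDelta (f : V) : V2 := \matrix_(i, j) ev f (wmul H i j).
Definition dS (f : V) : V := \row_l ev f (SH (bvec l)).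
(* unit of A^* is epsilon = weps H *)

Definition dual_grouplike (k kinv : V) : Prop :=
  [/\ dmulH k kinv = weps H, dmulH kinv k = weps H,
      dDelta k = mul2 dmul (tens k k) (dDelta (weps H)) &
      dDelta k = mul2 dmul (dDelta (weps H)) (tens k k)].

Definition dual_pivotal (k kinv : V) : Prop :=
  dual_grouplike k kinv /\
  forall f, dS (dS f) = dmulH (dmulH k f) kinv.

Definition left_ideal (m : 'I_n -> 'I_n -> V) (U : 'M[C]_n) : Prop :=
  forall f u : V, (u <= U)%MS -> (mulA m f u <= U)%MS.

Definition semisimple (m : 'I_n -> 'I_n -> V) : Prop :=
  forall U, left_ideal m U ->
  exists W, [/\ left_ideal m W, (U :&: W == (0 : 'M[C]_n))%MS & (U + W == 1%:M)%MS].

(* psi acts on column vectors W = C^p *)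
Definition drep (p : nat) (psi : V -> 'M[C]_p) : Prop :=
  [/\ (forall (c : C) f g, psi (c *: f + g) = c *: psi f + psi g),
      (forall f g, psi (dmulH f g) = psi f *m psi g) &
      psi (weps H) = 1%:M].

(* irreducible: W nonzero, and every psi-invariant subspace of W (the column
   space of X) is 0 or W *)
Definition irreducible (p : nat) (psi : V -> 'M[C]_p) : Prop :=
  (0 < p)%N /\
  forall X : 'M[C]_p, (forall f, ((psi f *m X)^T <= X^T)%MS) ->
    \rank X = 0%N \/ \rank X = p.

Definition rep_iso (p q : nat) (psi : V -> 'M[C]_p) (rho : V -> 'M[C]_q) :=
  exists (P : 'M[C]_(p, q)) (Q : 'M[C]_(q, p)),
    [/\ P *m Q = 1%:M, Q *m P = 1%:M & forall f, psi f *m P = P *m rho f].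

Definition tensrep (p q : nat) (psi : V -> 'M[C]_p) (rho : V -> 'M[C]_q)
  (u : V2) : 'M[C]_(p * q) :=
  \sum_i \sum_j u i j *: tensmx (psi (bvec i)) (rho (bvec j)).

End WeakHopf.
Arguments bvec {C n}.

Section Setting.
Variables (C : fieldType) (n : nat) (H : wha C n).
Local Notation V := 'rV[C]_n.
Variables (I : finType) (m : I -> nat) (psi : forall a : I, V -> 'M[C]_(m a)).

Definition irrep_family : Prop :=
  [/\ (forall a, drep H (psi a) /\ irreducible (psi a)),
      (forall a b, a != b -> ~ rep_iso (psi a) (psi b)) &
      (forall p (rho : V -> 'M[C]_p), drep H rho -> irreducible rho ->
        exists a, rep_iso (psi a) rho)].

Definition fusion (N : I -> I -> I -> nat)
  (Vt : forall a b c, 'I_(N a b c) -> 'M[C]_(m a * m b, m c))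
  (Wt : forall a b c, 'I_(N a b c) -> 'M[C]_(m c, m a * m b)) : Prop :=
  [/\ (forall a b f, tensrep (psi a) (psi b) (dDelta H f)
        = \sum_c \sum_(mu < N a b c) Vt a b c mu *m psi c f *m Wt a b c mu),
      (forall a b c (mu nu : 'I_(N a b c)),
        Wt a b c mu *m Vt a b c nu = (mu == nu)%:R%:M) &
      (forall a b c d (mu : 'I_(N a b c)) (nu : 'I_(N a b d)),
        c != d -> Wt a b c mu *m Vt a b d nu = 0)].

(* vacuum: f(1) = sum_a Tr(b_a psi_a(f)); E = {a | b_a <> 0};
   b_e = v_e u_e for e in E; l_a, r_a *)
Definition vacuum (N : I -> I -> I -> nat) (b : forall a, 'M[C]_(m a))
  (u : forall a, 'rV[C]_(m a)) (v : forall a, 'cV[C]_(m a))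
  (l r : I -> I) : Prop :=
  [/\ (forall f, ev f (wone H) = \sum_a \tr (b a *m psi a f)),
      (forall e, b e != 0 -> b e = v e *m u e),
      (forall a, b (l a) != 0 /\
        forall e, b e != 0 -> forall c,
          N e a c = (if (e == l a) && (a == c) then 1 else 0)%N) &
      (forall a, b (r a) != 0 /\
        forall e, b e != 0 -> forall c,
          N a e c = (if (e == r a) && (a == c) then 1 else 0)%N)].

(* conjugation: Z_a : W_{bar a} -> W_a^*, with inverse Zi a *)
Definition conjugation (bar : I -> I) (Z : forall a, 'M[C]_(m a, m (bar a)))
  (Zi : forall a, 'M[C]_(m (bar a), m a)) : Prop :=
  forall a, [/\ Z a *m Zi a = 1%:M, Zi a *m Z a = 1%:M &
    forall f, (psi a (dS H f))^T = Z a *m psi (bar a) f *m Zi a].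

(* zeta_c on W_{bar c} (x) W_c : zeta_c(xi (x) eta) = (Z_c xi)(eta) *)
Definition zeta (bar : I -> I) (Z : forall a, 'M[C]_(m a, m (bar a))) (c : I)
  : 'rV[C]_(m (bar c) * m c) :=
  \row_k Z c (mxtens_unindex k).2 (mxtens_unindex k).1.

(* theta_c in W_{bar c} (x) W_c with (phi (x) id) theta_c = Z_{bar c}^{-1} phi
   (using bar (bar c) = c) *)
Definition theta_prop (bar : I -> I) (hbar : forall a, bar (bar a) = a)
  (Zi : forall a, 'M[C]_(m (bar a), m a)) (c : I)
  (th : 'cV[C]_(m (bar c) * m c)) : Prop :=
  forall phi : 'rV[C]_(m (bar c)),
    (\col_j \sum_i phi 0 i * th (mxtens_index (i, j)) 0)
      = castmx (congr1 m (hbar c), erefl 1%N) (Zi (bar c) *m phi^T).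

End Setting.

(* Main.v *)
Require Import Defs.
From HB Require Import structures.
From Stdlib Require Import Classical_Prop.
From mathcomp Require Import all_boot all_order all_algebra.
From mathcomp Require Import mxtens ring.

(** Write B for the dual of A.  The functionals f |-> Tr (X psi_a(f)) decompose
    A into matrix coalgebras A_a, because B is semisimple and the base field is
    algebraically closed, and the fusion tensors describe the products A_a A_b.
    The element h of B acting on W_a by a multiple of b_a is an invariant
    functional on A: it vanishes on A_a A_b unless a = bar b, and the identity
    defining w_c turns h(S(x) y) into the trace form
    (xi_a / d_a) Tr (Y psi_a(k^-1) X) on A_a.  Hence the coproduct of Omega is,
    up to k, the inverse of the form h(S(x) y); since S is antimultiplicative
    on A, this gives the transfer map T(x) = S(x_(1)) k(x_(2)).

    The same identity shows that the source counital map sends the twisted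
    character of a to (d_a / xi_a) times the vacuum element of r_a, so that the
    numbers d_a / xi_a are multiplicative under fusion.  Frobenius reciprocity of
    the fusion multiplicities then gives the positivity of the d_a^2 and the
    equality of the global dimensions at l_a and r_a, hence that Omega is an
    idempotent. *)

Set Implicit Arguments.
Unset Strict Implicit.
Unset Printing Implicit Defensive.
Import Order.TTheory GRing.Theory Num.Theory.
Local Open Scope ring_scope.

(** * Sweedler calculus *)

(** Invariance alone leaves weights free: any nonzero scalars y_e may multiply b_e in h. The form on
    A_a is then scaled by y_{r_a}, and inverting it gives an element with coefficients (d_a / xi_a)
    / y_{r_a}, for which the transfer argument works equally well. The global dimension is the
    weight for which this element also squares to itself. Omega is weighted by l_a but the form by
    r_a, so the equality of the two global dimensions enters the transfer identity too, and not only
    idempotence.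

    The obstacle is that d_a is merely a complex square root of w_a w_{bar a}, so a global dimension
    could a priori vanish. Positivity is therefore reached through d_a / xi_a, whose product over a
    and bar a is d_a^2.

    The factor k in T compensates for S not being an involution: T(S(z)) = z_(1) k^-1(z_(2)), and
    group-likeness of k makes this multiplicative in z. *)

Definition lin (C : fieldType) (U W : lmodType C) (F : U -> W) : Prop :=
  forall c x y, F (c *: x + y) = c *: F x + F y.

Section Lin.
Variable C : fieldType.
Implicit Types U W X : lmodType C.

Lemma lin0 U W (F : U -> W) : lin F -> F 0 = 0.
Proof. by move=> F_lin; have := F_lin (-1) 0 0; rewrite scaleN1r addNr scaleN1r addNr. Qed.

Lemma linZ U W (F : U -> W) : lin F -> forall c x, F (c *: x) = c *: F x.
Proof. by move=> F_lin c x; rewrite -[c *: x]addr0 F_lin lin0 // addr0. Qed.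

Lemma linD U W (F : U -> W) : lin F -> forall x y, F (x + y) = F x + F y.
Proof. by move=> F_lin x y; rewrite -{1}[x]scale1r F_lin scale1r. Qed.

Lemma lin_sum U W (F : U -> W) : lin F ->
  forall (J : Type) (r : seq J) (P : pred J) (G : J -> U),
  F (\sum_(i <- r | P i) G i) = \sum_(i <- r | P i) F (G i).
Proof.
move=> F_lin J r P G; apply: (big_morph F) => [x y|]; first exact: linD.
exact: lin0.
Qed.

Lemma lin_id U : lin (fun x : U => x).
Proof. by []. Qed.

Lemma lin_comp U W X (G : W -> X) (F : U -> W) :
  lin G -> lin F -> lin (fun x => G (F x)).
Proof. by move=> G_lin F_lin c x y; rewrite F_lin G_lin. Qed.

Lemma lin_scalel U W (F : U -> C^o) (w : W) : lin F -> lin (fun x => F x *: w).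
Proof. by move=> F_lin c x y; rewrite F_lin scalerDl scalerA. Qed.

Lemma lin_scaler U W (c : C) (F : U -> W) : lin F -> lin (fun x => c *: F x).
Proof. by move=> F_lin d x y; rewrite F_lin scalerDr !scalerA mulrC. Qed.

End Lin.

Section Sweedler.
Variables (C : fieldType) (n : nat) (H : wha C n).
Local Notation V := 'rV[C]_n.
Local Notation "x ** y" := (mulH H x y) (at level 40, left associativity).
Local Notation S := (SH H).
Local Notation one := (wone H).
Local Notation eps := (epsH H).
Local Notation e_ := (@bvec C n).
Implicit Types (U : lmodType C) (x y z f g : V).

Lemma row_bvec x : x = \sum_i x 0 i *: e_ i.
Proof. exact: row_sum_delta. Qed.

Lemma lin_bvec U (F : V -> U) x : lin F -> F x = \sum_i x 0 i *: F (e_ i).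
Proof.
move=> F_lin; rewrite {1}(row_bvec x) (lin_sum F_lin).
by apply: eq_bigr => i _; rewrite (linZ F_lin).
Qed.

Lemma lin_eq U (F G : V -> U) : lin F -> lin G ->
  (forall i, F (e_ i) = G (e_ i)) -> F =1 G.
Proof.
move=> F_lin G_lin FG x; rewrite (lin_bvec x F_lin) (lin_bvec x G_lin).
by apply: eq_bigr => i _; rewrite FG.
Qed.

Lemma lin_ev f : lin (ev f : V -> C^o).
Proof.
move=> c x y; rewrite /ev scaler_sumr -big_split /=; apply: eq_bigr => i _.
by rewrite !mxE mulrDr mulrCA.
Qed.

Lemma evC f x : ev f x = ev x f.
Proof. by apply: eq_bigr => i _; rewrite mulrC. Qed.

Lemma lin_evl x : lin (fun f : V => ev f x : C^o).
Proof. by move=> c f g; rewrite !(evC _ x) lin_ev. Qed.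

Lemma ev_bvec f i : ev f (e_ i) = f 0 i.
Proof.
rewrite /ev (bigD1 i) //= big1 => [|j ne]; rewrite !mxE eqxx ?eqxx ?mulr1 ?addr0 //.
by rewrite (negPf ne) mulr0.
Qed.

Lemma ev_inj f g : (forall x, ev f x = ev g x) -> f = g.
Proof. by move=> fg; apply/rowP=> i; rewrite -!ev_bvec. Qed.

Lemma ev_injr x y : (forall f, ev f x = ev f y) -> x = y.
Proof. by move=> xy; apply: ev_inj => f; rewrite !(evC _ f). Qed.

Lemma lin_mulHr x : lin (mulH H x).
Proof.
move=> c y z; rewrite /mulH /Defs.mulA scaler_sumr -big_split /=.
apply: eq_bigr => i _; rewrite scaler_sumr -big_split /=; apply: eq_bigr => j _.
by rewrite !mxE scalerA -scalerDl mulrDr mulrCA.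
Qed.

Lemma lin_mulHl y : lin (fun x => x ** y).
Proof.
move=> c x z; rewrite /mulH /Defs.mulA scaler_sumr -big_split /=.
apply: eq_bigr => i _; rewrite scaler_sumr -big_split /=; apply: eq_bigr => j _.
by rewrite !mxE scalerA -scalerDl mulrDl mulrA.
Qed.

Lemma mulH_bvec i j : e_ i ** e_ j = wmul H i j.
Proof.
rewrite /mulH /Defs.mulA (bigD1 i) //= (bigD1 j) //= !mxE !eqxx mulr1 scale1r.
rewrite !big1 ?addr0 // => [i' /negPf ne|j' /negPf ne].
  by rewrite big1 // => j' _; rewrite !mxE ne mul0r scale0r.
by rewrite !mxE ne andbF mulr0 scale0r.
Qed.

Lemma lin_SH : lin S.
Proof. by move=> c x y; rewrite /SH mulmxDl scalemxAl. Qed.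

Lemma lin_Delta : lin (Delta H).
Proof.
move=> c x y; rewrite /Delta scaler_sumr -big_split /=; apply: eq_bigr => i _.
by rewrite !mxE scalerDl scalerA.
Qed.

Lemma Delta_bvec i : Delta H (e_ i) = wcop H i.
Proof.
rewrite /Delta (bigD1 i) //= big1 => [|j /negPf ne]; rewrite !mxE ?eqxx ?scale1r ?addr0 //.
by rewrite ne scale0r.
Qed.

(* Sweedler sum: [sweedler x F] is F(x_(1), x_(2)), only meaningful for bilinear F. *)
Definition sweedler U x (F : V -> V -> U) : U :=
  \sum_i \sum_j Delta H x i j *: F (e_ i) (e_ j).
Local Notation sw := sweedler.

Lemma eq_sw U x (F G : V -> V -> U) :
  (forall i j, F (e_ i) (e_ j) = G (e_ i) (e_ j)) -> sw x F = sw x G.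
Proof. by move=> FG; do 2!apply: eq_bigr => ? _; rewrite FG. Qed.

Lemma lin_sw U (F : V -> V -> U) : lin (fun x => sw x F).
Proof.
move=> c x y; rewrite /sweedler scaler_sumr -big_split /=; apply: eq_bigr => i _.
rewrite scaler_sumr -big_split /=; apply: eq_bigr => j _.
by rewrite lin_Delta !mxE scalerDl scalerA.
Qed.

Lemma lin_swr (W U : lmodType C) x (F : V -> V -> W -> U) :
  (forall a b, lin (F a b)) -> lin (fun w => sw x (fun a b => F a b w)).
Proof.
move=> F_lin c w w'; rewrite /sweedler scaler_sumr -big_split /=; apply: eq_bigr => i _.
rewrite scaler_sumr -big_split /=; apply: eq_bigr => j _.
by rewrite F_lin scalerDr !scalerA mulrC.
Qed.

Lemma lin_app_sw (U W : lmodType C) (G : U -> W) : lin G ->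
  forall x (F : V -> V -> U), G (sw x F) = sw x (fun a b => G (F a b)).
Proof.
move=> G_lin x F; rewrite (lin_sum G_lin); apply: eq_bigr => i _.
by rewrite (lin_sum G_lin); apply: eq_bigr => j _; rewrite (linZ G_lin).
Qed.

Lemma sw_exchange U x y (F : V -> V -> V -> V -> U) :
  sw x (fun a b => sw y (fun c d => F a b c d))
  = sw y (fun c d => sw x (fun a b => F a b c d)).
Proof.
rewrite /sweedler; transitivity (\sum_i \sum_j \sum_k \sum_l
   (Delta H x i j * Delta H y k l) *: F (e_ i) (e_ j) (e_ k) (e_ l)).
  do 2!apply: eq_bigr => ? _; rewrite scaler_sumr; apply: eq_bigr => ? _.
  by rewrite scaler_sumr; apply: eq_bigr => ? _; rewrite scalerA.
under eq_bigr do rewrite exchange_big /=.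
rewrite exchange_big /=; apply: eq_bigr => k _.
under eq_bigr do rewrite exchange_big /=.
rewrite exchange_big /=; apply: eq_bigr => l _.
rewrite scaler_sumr; apply: eq_bigr => i _; rewrite scaler_sumr; apply: eq_bigr => j _.
by rewrite scalerA mulrC.
Qed.

Lemma ev_dmulH f g x : ev (dmulH H f g) x = sw x (fun a b => ev f a * ev g b : C^o).
Proof.
move: x; apply: (@lin_eq C^o (ev _)); [exact: lin_ev | exact: lin_sw |] => l.
rewrite ev_bvec /dmulH /Defs.mulA summxE; apply: eq_bigr => i _.
rewrite summxE; apply: eq_bigr => j _.
by rewrite !mxE !ev_bvec Delta_bvec [RHS]mulrC.
Qed.

Lemma ev_dS f x : ev (dS H f) x = ev f (S x).
Proof.
move: x; apply: (@lin_eq C^o (ev _) (fun x => ev f (S x))); [exact: lin_ev | |].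
  by apply: lin_comp; [exact: lin_ev | exact: lin_SH].
by move=> l; rewrite ev_bvec mxE.
Qed.

Lemma ev_mulH f x y : ev f (x ** y) = \sum_i \sum_j dDelta H f i j * (x 0 i * y 0 j).
Proof.
have evl := @lin_ev f.
rewrite /mulH /Defs.mulA (lin_sum evl); apply: eq_bigr => i _.
rewrite (lin_sum evl); apply: eq_bigr => j _.
by rewrite (linZ evl) mxE [RHS]mulrC.
Qed.

Lemma ev_Delta f g x :
  \sum_i \sum_j f 0 i * Delta H x i j * g 0 j = ev (dmulH H f g) x.
Proof.
rewrite ev_dmulH; apply: eq_bigr => i _; apply: eq_bigr => j _.
by rewrite !ev_bvec mulrAC mulrC.
Qed.

End Sweedler.

Arguments lin_app_sw {C n H U W G}.
Arguments sweedler {C n} H {U} x F.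

(* Linearity in one slot of a multilinear expression in Sweedler legs. *)
Ltac linear_slot :=
  repeat first
  [ exact: lin_id | exact: lin_ev | exact: lin_evl | exact: lin_SH | exact: lin_mulHr
  | exact: lin_mulHl | exact: lin_sw | assumption | solve [auto]
  | match goal with
    | |- lin (fun x => mulH _ (@?F x) ?y) =>
        apply: (@lin_comp _ _ _ _ (fun z => mulH _ z y) F); [exact: lin_mulHl|]
    | |- lin (fun x => mulH ?h ?y (@?F x)) =>
        apply: (@lin_comp _ _ _ _ (mulH h y) F); [exact: lin_mulHr|]
    | |- lin (fun x => SH ?h (@?F x)) =>
        apply: (@lin_comp _ _ _ _ (SH h) F); [exact: lin_SH|]
    | |- lin (fun x => epsH ?h (@?F x)) =>
        apply: (@lin_comp _ _ _ _ (epsH h : _ -> _^o) F); [exact: lin_ev|]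
    | |- lin (fun x => ev ?f (@?F x)) =>
        apply: (@lin_comp _ _ _ _ (ev f : _ -> _^o) F); [exact: lin_ev|]
    | |- lin (fun x => sweedler ?h (@?F x) ?G) =>
        apply: (@lin_comp _ _ _ _ (fun z => sweedler h z G) F); [exact: lin_sw|]
    | |- lin (fun x => sweedler ?h ?y (@?F x)) =>
        apply: (@lin_swr _ _ _ _ _ y (fun a b w => F w a b)) => ? ? /=
    | Fl : forall b, lin (fun a => ?F a b) |- lin (fun x => ?F (@?G x) ?y) =>
        apply: (@lin_comp _ _ _ _ (fun z => F z y) G); [exact: Fl|]
    | Fr : forall a, lin (?F a) |- lin (fun x => ?F ?y (@?G x)) =>
        apply: (@lin_comp _ _ _ _ (F y) G); [exact: Fr|]
    | Fl : lin ?F |- lin (fun x => ?F (@?G x)) =>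
        apply: (@lin_comp _ _ _ _ F G); [exact: Fl|]
    | |- lin (fun x => (@?F x) *: ?w) => apply: (@lin_scalel _ _ _ F w)
    | |- lin (fun x => ?c *: (@?F x)) => apply: (@lin_scaler _ _ _ c F)
    end ].

(** * Weak bialgebra axioms as rules for Sweedler sums *)

Section Antipode.
Variables (C : fieldType) (n : nat) (H : wha C n).
Hypothesis whaH : is_wha H.
Local Notation V := 'rV[C]_n.
Local Notation "x ** y" := (mulH H x y) (at level 40, left associativity).
Local Notation S := (SH H).
Local Notation one := (wone H).
Local Notation eps := (epsH H).
Local Notation e_ := (@bvec C n).
Local Notation sw := (sweedler H).
Implicit Types (U : lmodType C) (x y z f g : V).

Lemma mulHA x y z : x ** y ** z = x ** (y ** z).
Proof. by case: whaH => [[->]]. Qed.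

Lemma mul1H x : one ** x = x.
Proof. by case: whaH => [[_ /(_ x) []]]. Qed.

Lemma mulH1 x : x ** one = x.
Proof. by case: whaH => [[_ /(_ x) []]]. Qed.

Lemma sw_coassoc U x (F : V -> V -> V -> U) :
  sw x (fun a b => sw a (fun p q => F p q b))
  = sw x (fun a b => sw b (fun p q => F a p q)).
Proof.
case: whaH => [[_ _ cA _ _] _]; rewrite /sweedler.
transitivity (\sum_a \sum_b \sum_c
  (\sum_j Delta H x j c * wcop H j a b) *: F (e_ a) (e_ b) (e_ c)).
  transitivity (\sum_j \sum_c \sum_a \sum_b
     (Delta H x j c * wcop H j a b) *: F (e_ a) (e_ b) (e_ c)).
    do 2!apply: eq_bigr => ? _; rewrite scaler_sumr; apply: eq_bigr => ? _.
    by rewrite scaler_sumr; apply: eq_bigr => ? _; rewrite scalerA Delta_bvec.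
  under eq_bigr do rewrite exchange_big /=.
  rewrite exchange_big /=; apply: eq_bigr => a _.
  under eq_bigr do rewrite exchange_big /=.
  rewrite exchange_big /=; apply: eq_bigr => b _.
  by rewrite exchange_big /=; apply: eq_bigr => c _; rewrite scaler_suml.
apply: eq_bigr => a _; rewrite [RHS](eq_bigr (fun j => \sum_b \sum_c
   (Delta H x a j * wcop H j b c) *: F (e_ a) (e_ b) (e_ c))); last first.
  move=> j _; rewrite scaler_sumr; apply: eq_bigr => b _.
  by rewrite scaler_sumr; apply: eq_bigr => c _; rewrite scalerA Delta_bvec.
rewrite [RHS]exchange_big /=; apply: eq_bigr => b _.
by rewrite [RHS]exchange_big /=; apply: eq_bigr => c _; rewrite cA scaler_suml.
Qed.

Lemma sw_counitl U x (F : V -> U) : lin F -> sw x (fun a b => eps a *: F b) = F x.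
Proof.
case: whaH => [[_ _ _ /(_ x) [cu _] _] _] F_lin; rewrite -{2}cu (lin_sum F_lin).
apply: eq_bigr => i _; rewrite (lin_sum F_lin); apply: eq_bigr => j _.
by rewrite (linZ F_lin) scalerA.
Qed.

Lemma sw_counitr U x (F : V -> U) : lin F -> sw x (fun a b => eps b *: F a) = F x.
Proof.
case: whaH => [[_ _ _ /(_ x) [_ cu] _] _] F_lin; rewrite -{2}cu (lin_sum F_lin).
apply: eq_bigr => i _; rewrite (lin_sum F_lin); apply: eq_bigr => j _.
by rewrite (linZ F_lin) scalerA.
Qed.

Lemma sw_mul U x y (F : V -> V -> U) :
    (forall b, lin (F^~ b)) -> (forall a, lin (F a)) ->
  sw (x ** y) F = sw x (fun a b => sw y (fun c d => F (a ** c) (b ** d))).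
Proof.
move=> Fl Fr; case: whaH => [[_ _ _ _ dM] _]; rewrite /sweedler dM.
pose L (M : 'M[C]_n) := \sum_i \sum_j M i j *: F (e_ i) (e_ j).
have L_lin : lin L.
  move=> c M M'; rewrite /L scaler_sumr -big_split; apply: eq_bigr => i _ /=.
  rewrite scaler_sumr -big_split; apply: eq_bigr => j _ /=.
  by rewrite !mxE scalerDl scalerA.
have L_tens p q : L (tens p q) = F p q.
  rewrite (lin_bvec p (Fl q)); apply: eq_bigr => i _.
  rewrite (lin_bvec q (Fr _)) scaler_sumr; apply: eq_bigr => j _.
  by rewrite !mxE big_ord1 !mxE scalerA.
rewrite -/(L _) (lin_sum L_lin); apply: eq_bigr => i _.
rewrite (lin_sum L_lin); apply: eq_bigr => j _.
rewrite (lin_sum L_lin) scaler_sumr; apply: eq_bigr => k _.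
rewrite (lin_sum L_lin) scaler_sumr; apply: eq_bigr => l _.
by rewrite (linZ L_lin) L_tens scalerA !mulH_bvec.
Qed.

Lemma sw_mull1 U x (F : V -> V -> U) :
    (forall b, lin (F^~ b)) -> (forall a, lin (F a)) ->
  sw one (fun a b => sw x (fun c d => F (a ** c) (b ** d))) = sw x F.
Proof. by move=> Fl Fr; rewrite -sw_mul // mul1H. Qed.

Lemma sw_mulr1 U x (F : V -> V -> U) :
    (forall b, lin (F^~ b)) -> (forall a, lin (F a)) ->
  sw x (fun a b => sw one (fun c d => F (a ** c) (b ** d))) = sw x F.
Proof. by move=> Fl Fr; rewrite -sw_mul // mulH1. Qed.

Lemma sum_mul3 U (s t : T3 C n) (G : V -> V -> V -> U) :
    (forall b c, lin (fun a => G a b c)) -> (forall a c, lin (fun b => G a b c)) ->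
    (forall a b, lin (G a b)) ->
  \sum_a \sum_b \sum_c mul3 (wmul H) s t a b c *: G (e_ a) (e_ b) (e_ c)
  = \sum_i1 \sum_i2 \sum_i3 \sum_j1 \sum_j2 \sum_j3
     (s i1 i2 i3 * t j1 j2 j3) *: G (e_ i1 ** e_ j1) (e_ i2 ** e_ j2) (e_ i3 ** e_ j3).
Proof.
move=> G1 G2 G3.
pose L (w : T3 C n) := \sum_a \sum_b \sum_c w a b c *: G (e_ a) (e_ b) (e_ c).
have L_sum (J : finType) (E : J -> T3 C n) :
    L (fun a b c => \sum_i E i a b c) = \sum_i L (E i).
  rewrite /L [RHS]exchange_big /=; apply: eq_bigr => a _.
  rewrite [RHS]exchange_big /=; apply: eq_bigr => b _.
  by rewrite [RHS]exchange_big /=; apply: eq_bigr => c _; rewrite scaler_suml.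
rewrite -/(L _) /mul3.
do 6!(rewrite L_sum; apply: eq_bigr => ? _).
rewrite !mulH_bvec (lin_bvec _ (G1 _ _)) scaler_sumr; apply: eq_bigr => a _.
rewrite (lin_bvec _ (G2 _ _)) !scaler_sumr; apply: eq_bigr => b _.
rewrite (lin_bvec _ (G3 _ _)) !scaler_sumr; apply: eq_bigr => c _.
by rewrite !scalerA !mulrA.
Qed.

Lemma sw_Delta2 U x (G : V -> V -> V -> U) :
  sw x (fun a b => sw a (fun p q => G p q b))
  = \sum_a \sum_b \sum_c Delta2 H x a b c *: G (e_ a) (e_ b) (e_ c).
Proof.
transitivity (\sum_j \sum_c \sum_a \sum_b
     (Delta H x j c * wcop H j a b) *: G (e_ a) (e_ b) (e_ c)).
  do 2!apply: eq_bigr => ? _; rewrite scaler_sumr; apply: eq_bigr => ? _.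
  by rewrite scaler_sumr; apply: eq_bigr => ? _; rewrite scalerA Delta_bvec.
under eq_bigr do rewrite exchange_big /=.
rewrite exchange_big /=; apply: eq_bigr => a _.
under eq_bigr do rewrite exchange_big /=.
rewrite exchange_big /=; apply: eq_bigr => b _.
by rewrite exchange_big /=; apply: eq_bigr => c _; rewrite scaler_suml.
Qed.

(** The weak unit axiom as a Sweedler rule. [Delta2_one_r] has the middle product in the opposite
    order; the agreement of the two is what later makes the images of [epss] and [epst] commute. *)
Lemma Delta2_one_l U (G : V -> V -> V -> U) :
    (forall b c, lin (fun a => G a b c)) -> (forall a c, lin (fun b => G a b c)) ->
    (forall a b, lin (G a b)) ->
  sw one (fun a b => sw a (fun p q => G p q b))
  = sw one (fun p q => sw one (fun c d => G p (c ** q) d)).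
Proof.
move=> G1 G2 G3; case: whaH => [_ [d1 _ _ _ _]]; rewrite sw_Delta2.
under eq_bigr => a _ do under eq_bigr => b _ do under eq_bigr => c _ do
  rewrite (proj1 (d1 a b c)).
rewrite sum_mul3 // sw_exchange.
transitivity (\sum_i2 \sum_i3 \sum_j1 \sum_j2 (Delta H one i2 i3 * Delta H one j1 j2)
   *: G (one ** e_ j1) (e_ i2 ** e_ j2) (e_ i3 ** one)); last first.
  do 2!apply: eq_bigr => ? _; rewrite scaler_sumr; apply: eq_bigr => ? _.
  rewrite scaler_sumr; apply: eq_bigr => ? _.
  by rewrite mul1H mulH1 scalerA.
rewrite exchange_big /=; apply: eq_bigr => i2 _.
rewrite exchange_big /=; apply: eq_bigr => i3 _.
rewrite exchange_big /=; apply: eq_bigr => j1 _.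
rewrite exchange_big /=; apply: eq_bigr => j2 _.
rewrite exchange_big /=.
have l1 : lin (fun a => G (a ** e_ j1) (e_ i2 ** e_ j2) (e_ i3 ** one)).
  by apply: (@lin_comp _ _ _ _ (fun a => G a _ _)); [exact: G1 | exact: lin_mulHl].
have l3 i1 : lin (fun b => G (e_ i1 ** e_ j1) (e_ i2 ** e_ j2) (e_ i3 ** b)).
  by apply: (@lin_comp _ _ _ _ (fun a => G _ _ a)); [exact: G3 | exact: lin_mulHr].
rewrite (lin_bvec one l1) scaler_sumr exchange_big /=; apply: eq_bigr => i1 _.
rewrite (lin_bvec one (l3 _)) !scaler_sumr; apply: eq_bigr => j3 _.
by rewrite !scalerA /one_x_Delta1 /Delta1_x_1; congr (_ *: _); ring.
Qed.

Lemma Delta2_one_r U (G : V -> V -> V -> U) :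
    (forall b c, lin (fun a => G a b c)) -> (forall a c, lin (fun b => G a b c)) ->
    (forall a b, lin (G a b)) ->
  sw one (fun a b => sw a (fun p q => G p q b))
  = sw one (fun p q => sw one (fun c d => G p (q ** c) d)).
Proof.
move=> G1 G2 G3; case: whaH => [_ [d1 _ _ _ _]]; rewrite sw_Delta2.
under eq_bigr => a _ do under eq_bigr => b _ do under eq_bigr => c _ do
  rewrite (proj2 (d1 a b c)).
rewrite sum_mul3 //.
transitivity (\sum_i1 \sum_i2 \sum_j2 \sum_j3 (Delta H one i1 i2 * Delta H one j2 j3)
   *: G (e_ i1 ** one) (e_ i2 ** e_ j2) (one ** e_ j3)); last first.
  do 2!apply: eq_bigr => ? _; rewrite scaler_sumr; apply: eq_bigr => ? _.
  rewrite scaler_sumr; apply: eq_bigr => ? _.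
  by rewrite mul1H mulH1 scalerA.
apply: eq_bigr => i1 _; apply: eq_bigr => i2 _.
under eq_bigr do rewrite exchange_big /=.
rewrite exchange_big /=; apply: eq_bigr => j2 _.
under eq_bigr do rewrite exchange_big /=.
rewrite exchange_big /=; apply: eq_bigr => j3 _.
have l1 : lin (fun a => G (e_ i1 ** a) (e_ i2 ** e_ j2) (one ** e_ j3)).
  by apply: (@lin_comp _ _ _ _ (fun a => G a _ _)); [exact: G1 | exact: lin_mulHr].
have l3 j1 : lin (fun b => G (e_ i1 ** e_ j1) (e_ i2 ** e_ j2) (b ** e_ j3)).
  by apply: (@lin_comp _ _ _ _ (fun a => G _ _ a)); [exact: G3 | exact: lin_mulHl].
rewrite (lin_bvec one l1) scaler_sumr exchange_big /=; apply: eq_bigr => j1 _.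
rewrite (lin_bvec one (l3 _)) !scaler_sumr; apply: eq_bigr => i3 _.
by rewrite !scalerA /one_x_Delta1 /Delta1_x_1; congr (_ *: _); ring.
Qed.

End Antipode.

(** * Counital maps and antipode *)

Section Counital.
Variables (C : fieldType) (n : nat) (H : wha C n).
Hypothesis whaH : is_wha H.
Local Notation V := 'rV[C]_n.
Local Notation "x ** y" := (mulH H x y) (at level 40, left associativity).
Local Notation S := (SH H).
Local Notation one := (wone H).
Local Notation eps := (epsH H).
Local Notation e_ := (@bvec C n).
Local Notation sw := (sweedler H).
Local Notation mulHA := (mulHA whaH).
Implicit Types (U : lmodType C) (x y z f g : V).

(** The source and target counital maps. In an ordinary Hopf algebra both are x |-> eps(x) 1; here
    their images take over the role of the scalars. *)
Definition epss x : V := sw one (fun a b => eps (x ** b) *: a).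
Definition epst x : V := sw one (fun a b => eps (a ** x) *: b).

Lemma lin_epss : lin epss.
Proof. by rewrite /epss; linear_slot. Qed.

Lemma epss_antipode x : sw x (fun a b => S a ** b) = epss x.
Proof. by case: whaH => [_ [_ _ e _ _]]; rewrite /sweedler e; do 2!apply: eq_bigr => ? _; rewrite scalerA. Qed.

Lemma epst_antipode x : sw x (fun a b => a ** S b) = epst x.
Proof.
by case: whaH => [_ [_ _ _ e _]]; rewrite /sweedler e; do 2!apply: eq_bigr => ? _; rewrite scalerA mulrC.
Qed.

Lemma eps_mul_l x z : eps (x ** z) = sw one (fun a b => eps (x ** b) * eps (a ** z) : C^o).
Proof.
case: whaH => [_ [_ e3 _ _ _]]; have [_] := e3 x one z; rewrite (mulH1 whaH) => ->.
by do 2!apply: eq_bigr => ? _; rewrite -mulrA.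
Qed.

Lemma eps_epss x : eps (epss x) = eps x.
Proof.
rewrite /epss (lin_app_sw (G := eps : V -> C^o)); last exact: lin_ev.
rewrite -[in RHS](mulH1 whaH x) eps_mul_l; apply: (@eq_sw _ _ _ C^o) => i j.
by rewrite (mulH1 whaH) (linZ (F := eps : V -> C^o)) //; exact: lin_ev.
Qed.

Lemma epss_mul x y : epss (x ** y) = epss (epss x ** y).
Proof.
rewrite {1 2}/epss; apply: eq_sw => i j; congr (_ *: _).
rewrite mulHA eps_mul_l /epss.
have l : lin (fun z => eps (z ** y ** e_ j) : C^o) by linear_slot.
rewrite (lin_app_sw l); apply: (@eq_sw _ _ _ C^o) => k m.
by rewrite (linZ l) mulHA.
Qed.

Lemma epst_mul x y : epst (x ** y) = epst (x ** epst y).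
Proof.
rewrite {1 2}/epst; apply: eq_sw => i j; congr (_ *: _).
rewrite -mulHA eps_mul_l /epst.
have l : lin (fun z => eps (e_ i ** (x ** z)) : C^o) by linear_slot.
rewrite (lin_app_sw l); apply: (@eq_sw _ _ _ C^o) => k m.
by rewrite (linZ l) -mulHA [RHS]mulrC.
Qed.

(** Writing x as 1 x puts a second Delta(1) beside the one inside [epst]. Together they form the
    triple coproduct of 1, and the counit then removes the middle leg. *)
Lemma sw_epst U x (F : V -> V -> U) :
    (forall b, lin (F^~ b)) -> (forall a, lin (F a)) ->
  sw x (fun a b => F a (epst b)) = sw one (fun a b => F (a ** x) b).
Proof.
move=> Fl Fr; transitivity (sw x (fun a b => sw one (fun c d => eps (c ** b) *: F a d))).
  apply: eq_sw => i j; rewrite /epst (lin_app_sw (Fr _)); apply: eq_sw => k m.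
  by rewrite (linZ (Fr _)).
rewrite -(sw_mull1 whaH x); [|move=> ?; linear_slot..].
rewrite sw_exchange.
transitivity (sw x (fun a b => sw one (fun r d =>
    sw r (fun p q => eps (q ** b) *: F (p ** a) d)))).
  apply: eq_sw => i j.
  rewrite (Delta2_one_l whaH (G := fun p q d => eps (q ** e_ j) *: F (p ** e_ i) d));
    try (move=> ? ?; linear_slot).
  by do 2!(apply: eq_sw => ? ?); rewrite mulHA.
rewrite sw_exchange; apply: eq_sw => r d.
rewrite -(sw_counitr whaH (e_ r ** x) (F := F^~ (e_ d))) //.
rewrite (sw_mul whaH); [|move=> ?; linear_slot..].
by rewrite sw_exchange.
Qed.

Lemma antipode_epst x : sw x (fun a b => S a ** epst b) = S x.
Proof.
case: whaH => [_ [_ _ _ _ /(_ x) <-]].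
rewrite -(sw_Delta2 H x (fun a b c => S a ** b ** S c)) (sw_coassoc whaH).
apply: eq_sw => i j; rewrite -epst_antipode (lin_app_sw (@lin_mulHr _ _ H _)).
by apply: eq_sw => k m; rewrite mulHA.
Qed.

Lemma antipode_epss x : sw x (fun a b => epss a ** S b) = S x.
Proof.
case: whaH => [_ [_ _ _ _ /(_ x) <-]].
rewrite -(sw_Delta2 H x (fun a b c => S a ** b ** S c)).
by apply: eq_sw => i j; rewrite -epss_antipode (lin_app_sw (@lin_mulHl _ _ H _)).
Qed.

(** [epst y] is a contracted right leg of Delta(1), so its coproduct is a contracted triple
    coproduct of 1; splitting that one leaves y in the first leg only. *)
Lemma sw_of_epst U y (F : V -> V -> U) :
    (forall b, lin (F^~ b)) -> (forall a, lin (F a)) ->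
  sw (epst y) F = sw one (fun a b => F (a ** epst y) b).
Proof.
move=> Fl Fr; rewrite {1}/epst (lin_app_sw (G := fun z => sw z F)); last exact: lin_sw.
transitivity (sw one (fun c d => sw d (fun p q => eps (c ** y) *: F p q))).
  apply: eq_sw => i j; rewrite (linZ (F := fun z => sw z F)); last exact: lin_sw.
  by rewrite -(lin_app_sw (G := fun w => eps (e_ i ** y) *: w)) //; apply: lin_scaler.
rewrite -(sw_coassoc whaH) (Delta2_one_l whaH); try (move=> ? ?; linear_slot).
rewrite sw_exchange; apply: eq_sw => i j.
have l : lin (fun z => F (e_ i ** z) (e_ j)) by linear_slot.
rewrite /epst (lin_app_sw l); apply: eq_sw => k m.
by rewrite (linZ l).
Qed.

Lemma sw_of_epss U x (F : V -> V -> U) :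
    (forall b, lin (F^~ b)) -> (forall a, lin (F a)) ->
  sw (epss x) F = sw one (fun a b => F a (epss x ** b)).
Proof.
move=> Fl Fr; rewrite {1}/epss (lin_app_sw (G := fun z => sw z F)); last exact: lin_sw.
transitivity (sw one (fun c d => sw c (fun p q => eps (x ** d) *: F p q))).
  apply: eq_sw => i j; rewrite (linZ (F := fun z => sw z F)); last exact: lin_sw.
  by rewrite -(lin_app_sw (G := fun w => eps (x ** e_ j) *: w)) //; apply: lin_scaler.
rewrite (Delta2_one_l whaH (G := fun p q d => eps (x ** d) *: F p q));
  try (move=> ? ?; linear_slot).
apply: eq_sw => i j.
have l : lin (fun z => F (e_ i) (z ** e_ j)) by linear_slot.
rewrite /epss (lin_app_sw l); apply: eq_sw => k m.
by rewrite (linZ l).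
Qed.

(** One may replace y by [epst y], whose coproduct is Delta(1) times [epst y] in the first leg; the
    remaining Delta(1) is absorbed by the coproduct of x. *)
Lemma epst_conj x y : epst (x ** y) = sw x (fun a b => a ** epst y ** S b).
Proof.
rewrite epst_mul -epst_antipode (sw_mul whaH); [|move=> ?; linear_slot..].
rewrite -[RHS](sw_mulr1 whaH); [|move=> ?; linear_slot..].
apply: eq_sw => i j; rewrite sw_of_epst; [|move=> ?; linear_slot..].
by apply: eq_sw => k m; rewrite !mulHA.
Qed.

Lemma epss_conj x y : epss (x ** y) = sw y (fun a b => S a ** epss x ** b).
Proof.
rewrite epss_mul -epss_antipode (sw_mul whaH); [|move=> ?; linear_slot..].
rewrite sw_of_epss; [|move=> ?; linear_slot..].
rewrite -[RHS](sw_mull1 whaH); [|move=> ?; linear_slot..].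
by do 2!(apply: eq_sw => ? ?); rewrite !mulHA.
Qed.

(** Both products are the middle leg of a triple coproduct of 1 whose outer legs are paired with x
    and y. The two forms of the weak unit axiom differ exactly in the order of the middle
    product. *)
Lemma epst_epss_comm x y : epst y ** epss x = epss x ** epst y.
Proof.
have l1 := @lin_mulHl _ _ H (epss x); have l2 := @lin_mulHr _ _ H (epss x).
pose G p q r : V := eps (p ** y) *: (eps (x ** r) *: q).
have G1 b c : lin (fun a => G a b c) by rewrite /G; linear_slot.
have G2 a c : lin (fun b => G a b c) by rewrite /G; linear_slot.
have G3 a b : lin (G a b) by rewrite /G; linear_slot.
transitivity (sw one (fun p q => sw one (fun c d => G p (q ** c) d))).
  rewrite {1}/epst (lin_app_sw l1); apply: eq_sw => i j.
  rewrite (linZ l1) /epss (lin_app_sw (@lin_mulHr _ _ H (e_ j))).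
  rewrite (lin_app_sw (G := fun w => eps (e_ i ** y) *: w)); last exact: lin_scaler.
  by apply: eq_sw => k m; rewrite /G (linZ (@lin_mulHr _ _ H _)).
rewrite -(Delta2_one_r whaH) // (Delta2_one_l whaH) //.
rewrite {1}/epst (lin_app_sw l2); apply: eq_sw => i j.
rewrite (linZ l2) /epss (lin_app_sw (@lin_mulHl _ _ H (e_ j))).
rewrite (lin_app_sw (G := fun w => eps (e_ i ** y) *: w)); last exact: lin_scaler.
by apply: eq_sw => k m; rewrite /G (linZ (@lin_mulHl _ _ H _)).
Qed.

End Counital.

(** * Antimultiplicativity of the antipode and the algebra structure of the dual *)

Section AntipodeMul.
Variables (C : fieldType) (n : nat) (H : wha C n).
Hypothesis whaH : is_wha H.
Local Notation V := 'rV[C]_n.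
Local Notation "x ** y" := (mulH H x y) (at level 40, left associativity).
Local Notation S := (SH H).
Local Notation one := (wone H).
Local Notation eps := (epsH H).
Local Notation e_ := (@bvec C n).
Local Notation sw := (sweedler H).
Local Notation mulHA := (mulHA whaH).
Local Notation linr := (@lin_mulHr _ _ H _).
Local Notation linl := (@lin_mulHl _ _ H _).
Implicit Types (U : lmodType C) (x y z f g : V).

(** The chain is S(xy) = S(x_(1) y_(1)) epst(x_(2) y_(2)) = S(x_(1) y_(1)) x_(2) y_(2) S(y_(3))
    S(x_(3)) = epss(x_(1) y_(1)) S(y_(2)) S(x_(2)) = S(y_(1)) epss(x_(1)) epst(y_(2)) S(x_(2)).
    Commuting the two counital elements lets each be absorbed by its own antipode. *)
Lemma antipode_mul x y : S (x ** y) = S y ** S x.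
Proof.
rewrite -{1}(antipode_epst whaH) (sw_mul whaH); [|move=> ?; rewrite ?/epst; linear_slot..].
transitivity (sw x (fun a b => sw b (fun p q => sw y (fun c d => sw d (fun r s =>
    S (a ** c) ** (p ** r) ** (S s ** S q)))))).
  apply: eq_sw => a b; rewrite sw_exchange; apply: eq_sw => c d.
  rewrite (epst_conj whaH) (lin_app_sw linr); apply: eq_sw => p q.
  have l : lin (fun z => S (e_ a ** e_ c) ** (e_ p ** z ** S (e_ q))) by linear_slot.
  rewrite -(epst_antipode whaH) (lin_app_sw l); apply: eq_sw => r s.
  by rewrite !mulHA.
rewrite -(sw_coassoc whaH).
transitivity (sw x (fun a b => sw y (fun c d => epss H (a ** c) ** (S d ** S b)))).
  apply: eq_sw => a b; transitivity (sw (e_ a) (fun a1 a2 => sw y (fun c d =>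
    sw c (fun c1 c2 => S (a1 ** c1) ** (a2 ** c2) ** (S d ** S (e_ b)))))).
    by apply: eq_sw => a1 a2; rewrite (sw_coassoc whaH).
  rewrite sw_exchange; apply: eq_sw => c d.
  rewrite -(epss_antipode whaH) (lin_app_sw linl) (sw_mul whaH) //;
    by move=> ?; linear_slot.
transitivity (sw x (fun a b => sw y (fun c d => S c ** epst H d ** (epss H a ** S b)))).
  apply: eq_sw => a b; transitivity (sw y (fun c d => sw c (fun c1 c2 =>
      S c1 ** epss H (e_ a) ** c2 ** (S d ** S (e_ b))))).
    by apply: eq_sw => c d; rewrite (epss_conj whaH) (lin_app_sw linl).
  rewrite (sw_coassoc whaH); apply: eq_sw => c d.
  have l : lin (fun z => S (e_ c) ** epss H (e_ a) ** z ** S (e_ b)) by linear_slot.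
  rewrite mulHA -(mulHA (epst H _)) (epst_epss_comm whaH) -!mulHA.
  rewrite -(epst_antipode whaH) (lin_app_sw l); apply: eq_sw => p q.
  by rewrite !mulHA.
rewrite -[in RHS](antipode_epst whaH y) -[in RHS](antipode_epss whaH x).
rewrite (lin_app_sw linr); apply: eq_sw => a b.
by rewrite (lin_app_sw linl).
Qed.

Lemma dmulHA f g h : dmulH H (dmulH H f g) h = dmulH H f (dmulH H g h).
Proof.
apply: ev_inj => x; rewrite !ev_dmulH.
transitivity (sw x (fun a b => sw a (fun p q => ev f p * ev g q * ev h b : C^o))).
  apply: (@eq_sw _ _ _ C^o) => i j; rewrite ev_dmulH.
  rewrite (lin_app_sw (G := fun z : C^o => z * ev h (e_ j) : C^o)) //.
  by move=> c z z'; rewrite mulrDl -scalerAl.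
rewrite (sw_coassoc whaH); apply: (@eq_sw _ _ _ C^o) => i j; rewrite ev_dmulH.
rewrite (lin_app_sw (G := fun z : C^o => ev f (e_ i) * z : C^o)); last first.
  by move=> c z z'; rewrite mulrDr; congr (_ + _); exact: mulrCA.
by apply: (@eq_sw _ _ _ C^o) => k l; rewrite mulrA.
Qed.

Lemma dmul1H f : dmulH H (weps H) f = f.
Proof.
by apply: ev_inj => x; rewrite ev_dmulH (sw_counitl whaH x (@lin_ev _ _ f)).
Qed.

Lemma dmulH1 f : dmulH H f (weps H) = f.
Proof.
apply: ev_inj => x; rewrite ev_dmulH -(sw_counitr whaH x (@lin_ev _ _ f)).
by apply: (@eq_sw _ _ _ C^o) => i j; rewrite [LHS]mulrC.
Qed.

(** The action of the dual on A that is transpose to right multiplication by f. *)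
Definition hit f x : V := sw x (fun a b => ev f b *: a).

Lemma ev_hit f g x : ev g (hit f x) = ev (dmulH H g f) x.
Proof.
rewrite ev_dmulH /hit (lin_app_sw (@lin_ev _ _ g)); apply: (@eq_sw _ _ _ C^o) => i j.
by rewrite (linZ (@lin_ev _ _ g)) [LHS]mulrC.
Qed.

Lemma lin_hit f : lin (hit f).
Proof. by rewrite /hit; linear_slot. Qed.

(** * Group-like elements of the dual *)

Section Grouplike.
Variables k kinv : V.
Hypothesis k_gl : dual_grouplike H k kinv.

(** k is multiplicative only up to a counit factor. The two equations for the coproduct of k place
    this factor on the second legs, as here, or on the first legs, where [hit_mul] can absorb it. *)
Lemma grouplike_mul_l x y :
  ev k (x ** y) = sw x (fun a b => sw y (fun c d => ev k a * ev k c * eps (b ** d) : C^o)).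
Proof.
case: k_gl => _ _ Dk _.
rewrite ev_mulH Dk.
transitivity (\sum_i \sum_j \sum_p \sum_q \sum_r \sum_s
   (x 0 i * y 0 j) * (k 0 p * k 0 q * epsH H (wmul H r s) * (wcop H i p r * wcop H j q s))).
  do 2!apply: eq_bigr => ? _; rewrite mulrC /mul2 summxE mulr_sumr.
  apply: eq_bigr => p _; rewrite summxE mulr_sumr; apply: eq_bigr => q _.
  rewrite summxE mulr_sumr; apply: eq_bigr => r _.
  rewrite summxE mulr_sumr; apply: eq_bigr => s _.
  by rewrite !mxE !big_ord1 !mxE.
have lx : lin (fun x => sw x (fun a b =>
   sw y (fun c d => ev k a * ev k c * eps (b ** d) : C^o))) by exact: lin_sw.
rewrite (lin_bvec x lx); apply: eq_bigr => i _.
have ly : lin (fun y => sw (e_ i) (fun a b =>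
   sw y (fun c d => ev k a * ev k c * eps (b ** d) : C^o))) by linear_slot.
rewrite (lin_bvec y ly) scaler_sumr; apply: eq_bigr => j _.
rewrite scalerA scaler_sumr; apply: eq_bigr => p _.
rewrite exchange_big scaler_sumr; apply: eq_bigr => r _ /=.
rewrite !scaler_sumr; apply: eq_bigr => q _.
rewrite !scaler_sumr; apply: eq_bigr => s _.
rewrite !ev_bvec !Delta_bvec mulH_bvec !scalerA /GRing.scale /=; ring.
Qed.

Lemma grouplike_mul_r x y :
  ev k (x ** y) = sw x (fun a b => sw y (fun c d => eps (a ** c) * (ev k b * ev k d) : C^o)).
Proof.
case: k_gl => _ _ _ Dk.
rewrite ev_mulH Dk.
transitivity (\sum_i \sum_j \sum_p \sum_q \sum_r \sum_s
   (x 0 i * y 0 j) * (epsH H (wmul H p q) * (k 0 r * k 0 s) * (wcop H i p r * wcop H j q s))).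
  do 2!apply: eq_bigr => ? _; rewrite mulrC /mul2 summxE mulr_sumr.
  apply: eq_bigr => p _; rewrite summxE mulr_sumr; apply: eq_bigr => q _.
  rewrite summxE mulr_sumr; apply: eq_bigr => r _.
  rewrite summxE mulr_sumr; apply: eq_bigr => s _.
  by rewrite !mxE !big_ord1 !mxE.
have lx : lin (fun x => sw x (fun a b =>
   sw y (fun c d => eps (a ** c) * (ev k b * ev k d) : C^o))) by exact: lin_sw.
rewrite (lin_bvec x lx); apply: eq_bigr => i _.
have ly : lin (fun y => sw (e_ i) (fun a b =>
   sw y (fun c d => eps (a ** c) * (ev k b * ev k d) : C^o))) by linear_slot.
rewrite (lin_bvec y ly) scaler_sumr; apply: eq_bigr => j _.
rewrite scalerA scaler_sumr; apply: eq_bigr => p _.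
rewrite exchange_big scaler_sumr; apply: eq_bigr => r _ /=.
rewrite !scaler_sumr; apply: eq_bigr => q _.
rewrite !scaler_sumr; apply: eq_bigr => s _.
rewrite !ev_bvec !Delta_bvec mulH_bvec !scalerA /GRing.scale /=; ring.
Qed.

(** Expanding k on the second leg of xy gives x_(1) y_(1) eps(x_(2) y_(2)) k(x_(3)) k(y_(3)), and
    the counit cancels against the coproduct of x_(1) y_(1). *)
Lemma hit_mul x y : hit k (x ** y) = hit k x ** hit k y.
Proof.
rewrite /hit (sw_mul whaH); [|move=> ?; linear_slot..].
pose K a c b d : V := (ev k b * ev k d) *: (a ** c).
transitivity (sw x (fun a b => sw b (fun p q => sw y (fun c d => sw d (fun r s =>
    eps (p ** r) *: K a c q s))))).
  apply: eq_sw => a b; rewrite sw_exchange; apply: eq_sw => c d.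
  have l : lin (fun z : C^o => z *: (e_ a ** e_ c)) by apply: lin_scalel.
  rewrite grouplike_mul_r (lin_app_sw l); apply: eq_sw => p q.
  by rewrite (lin_app_sw l); apply: eq_sw => r s; rewrite scalerA.
rewrite -(sw_coassoc whaH) (lin_app_sw linl); apply: eq_sw => a b.
transitivity (sw (e_ a) (fun p q => sw y (fun c d => sw c (fun r s =>
    eps (q ** s) *: K p r (e_ b) d)))).
  by apply: eq_sw => p q; rewrite -(sw_coassoc whaH).
rewrite sw_exchange (lin_app_sw linr); apply: eq_sw => c d.
rewrite (linZ linl) (linZ linr) scalerA.
have l : lin (fun z : V => (ev k (e_ b) * ev k (e_ d)) *: z) by apply: lin_scaler.
rewrite -(sw_counitr whaH (e_ a ** e_ c) l) (sw_mul whaH) //; by move=> ?; linear_slot.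
Qed.

Hypothesis dSM : forall f g, dS H (dmulH H f g) = dmulH H (dS H g) (dS H f).

(** [dSM] is the dual form of S reversing coproducts on A; testing it on coordinate functionals
    turns it into a Sweedler rule. It is discharged by [dS_mul]. *)
Lemma sw_antipode U x (F : V -> V -> U) :
    (forall b, lin (F^~ b)) -> (forall a, lin (F a)) ->
  sw (S x) F = sw x (fun a b => F (S b) (S a)).
Proof.
move=> Fl Fr; rewrite {1}/sweedler.
have D i j : Delta H (S x) i j = sw x (fun a b => S b 0 i * S a 0 j : C^o).
  have <- : ev (dmulH H (e_ i) (e_ j)) (S x) = Delta H (S x) i j.
    rewrite -ev_Delta (bigD1 i) //= (bigD1 j) //= !mxE !eqxx !mul1r !mulr1.
    rewrite !big1 ?addr0 // => [i' /negPf ne|j' /negPf ne].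
      by rewrite big1 // => j' _; rewrite !mxE ne !mul0r.
    by rewrite !mxE ne andbF !mulr0.
  rewrite -ev_dS dSM ev_dmulH; apply: (@eq_sw _ _ _ C^o) => a b.
  by rewrite !ev_dS !(evC (e_ _)) !ev_bvec mulrC.
transitivity (\sum_i \sum_j sw x (fun a b => (S b 0 i * S a 0 j) *: F (e_ i) (e_ j))).
  do 2!apply: eq_bigr => ? _; rewrite D.
  by rewrite (lin_app_sw (G := fun z : C^o => z *: _)) //; apply: lin_scalel.
rewrite /sweedler; under eq_bigr do rewrite exchange_big /=.
rewrite exchange_big /=; apply: eq_bigr => a _.
under eq_bigr do rewrite exchange_big /=.
rewrite exchange_big /=; apply: eq_bigr => b _.
rewrite (lin_bvec (S (e_ b)) (Fl _)) scaler_sumr; apply: eq_bigr => i _.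
rewrite (lin_bvec (S (e_ a)) (Fr _)) !scaler_sumr; apply: eq_bigr => j _.
by rewrite !scalerA mulrA.
Qed.

(** k(S(x_(1)) x_(2)) expands to k(S(x_(1))) eps(S(x_(2)) x_(3)) k(x_(4)). The middle factor is
    eps(epss(x_(2))) = eps(x_(2)) and disappears. *)
Lemma grouplike_epss x : ev k (epss H x) = ev (dmulH H (dS H k) k) x.
Proof.
rewrite -(epss_antipode whaH) (lin_app_sw (@lin_ev _ _ k)) ev_dmulH.
pose G u v r s : C^o := eps (S v ** r) * (ev k (S u) * ev k s).
transitivity (sw x (fun a b => sw a (fun u v => sw b (fun r s => G u v r s)))).
  apply: (@eq_sw _ _ _ C^o) => a b; rewrite grouplike_mul_r.
  rewrite sw_antipode //; move=> ?; apply: lin_swr => ? ?; move=> c z z'.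
    by rewrite /epsH (@lin_mulHl _ _ H) lin_ev /GRing.scale /=; ring.
  by rewrite lin_ev /GRing.scale /=; ring.
rewrite (sw_coassoc whaH); apply: (@eq_sw _ _ _ C^o) => u t.
rewrite -(sw_coassoc whaH) ev_dS.
have l : lin (fun z => ev k (S (e_ u)) * ev k z : C^o).
  by move=> c z z'; rewrite lin_ev /GRing.scale /=; ring.
rewrite -(sw_counitl whaH (e_ t) l); apply: (@eq_sw _ _ _ C^o) => p s.
rewrite -(eps_epss whaH) -(epss_antipode whaH).
have l' : lin (fun z => eps z *: (ev k (S (e_ u)) * ev k (e_ s) : C^o)).
  by apply: lin_scalel; exact: lin_ev.
by rewrite (lin_app_sw l').
Qed.

(** Expanding k(x 1) gives k(x_(1)) k(epss(x_(2))), that is k = k (S(k) k). Cancelling k leaves S(k)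
    k = eps. *)
Lemma dS_grouplike : dS H k = kinv.
Proof.
case: k_gl => kk' k'k _ _.
have E : dmulH H (dS H k) k = weps H.
  suff E : k = dmulH H k (dmulH H (dS H k) k).
    by rewrite -[LHS]dmul1H -k'k dmulHA -E k'k.
  apply: ev_inj => x; rewrite -{1}(mulH1 whaH x) grouplike_mul_l ev_dmulH.
  apply: (@eq_sw _ _ _ C^o) => a b; rewrite -grouplike_epss.
  rewrite /epss (lin_app_sw (@lin_ev _ _ k)).
  rewrite (lin_app_sw (G := fun z : C^o => ev k (e_ a) * z : C^o)); last first.
    by move=> c z z'; rewrite mulrDr; congr (_ + _); exact: mulrCA.
  apply: (@eq_sw _ _ _ C^o) => c d.
  by rewrite (linZ (@lin_ev _ _ k)) -mulrA; congr (_ * _); rewrite [LHS]mulrC.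
by rewrite -[LHS]dmulH1 -kk' -dmulHA E dmul1H.
Qed.

End Grouplike.
End AntipodeMul.

(** * Irreducible representations *)

Section Representations.
Variables (C : fieldType) (n : nat) (H : wha C n).
Local Notation V := 'rV[C]_n.

(** Modules consist of columns, so rows are functionals: a stable row space is the annihilator of a
    submodule, that is, the dual of a quotient module. *)
Definition stable q k (Psi : V -> 'M[C]_q) (K : 'M[C]_(k, q)) :=
  forall f, (K *m Psi f <= K)%MS.

Lemma minimal_stable q (Psi : V -> 'M[C]_q) (K : 'M[C]_q) :
    K != 0 -> stable Psi K ->
  exists K' : 'M[C]_q, [/\ K' != 0, (K' <= K)%MS, stable Psi K' &
    forall L : 'M[C]_q, stable Psi L -> L != 0 -> (L <= K')%MS -> (K' <= L)%MS].
Proof.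
have [s] := ubnP (\rank K); elim: s K => // s IHs K ltKs K0 stK.
have [[L [stL L0 sLK nKL]]|min] := classic (exists L : 'M[C]_q,
    [/\ stable Psi L, L != 0, (L <= K)%MS & ~~ (K <= L)%MS]).
  have ltLK : (\rank L < \rank K)%N by rewrite rank_ltmx // /ltmx sLK.
  have [|K' [K'0 sK'L stK' minK']] := IHs L _ L0 stL.
    exact: leq_trans ltLK _.
  by exists K'; split=> //; apply: submx_trans sLK.
exists K; split=> // L stL L0 sLK; apply/negPn/negP => nKL.
by apply: min; exists L.
Qed.

(** A minimal stable row space is dual to a simple quotient, and [rho] is the action on that
    quotient. The functionals killing an invariant X, pulled back along R, form a stable space
    inside the minimal one, so they vanish or are everything. *)
Lemma irreducible_cut q (Psi : V -> 'M[C]_q) (K : 'M[C]_q) :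
    drep H Psi -> K != 0 -> stable Psi K ->
  exists p (rho : V -> 'M[C]_p) (R : 'M[C]_(p, q)),
    [/\ drep H rho, irreducible rho, row_free R, (R <= K)%MS &
        forall f, R *m Psi f = rho f *m R].
Proof.
move=> [Psi_lin PsiM Psi1] K0 stK.
have [K' [K'0 sK'K stK' minK']] := minimal_stable K0 stK.
set R := row_base K'; have Rfree : row_free R by exact: row_base_free.
have eqR : (R :=: K')%MS by exact: eq_row_base.
have stR : stable Psi R by move=> f; rewrite (eqmxMr _ eqR) eqR.
pose rho f := R *m Psi f *m pinvmx R.
have rhoP f : R *m Psi f = rho f *m R by rewrite mulmxKpV.
have Rinj : injective (fun X : 'M_(\rank K') => X *m R) by apply: row_free_inj.
exists (\rank K'), rho, R; split=> //; last by rewrite eqR.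
- split=> [c f g|f g|].
  + by rewrite /rho Psi_lin mulmxDr mulmxDl -scalemxAr -scalemxAl.
  + by apply: Rinj; rewrite /= -rhoP PsiM mulmxA rhoP -mulmxA rhoP mulmxA.
  + by apply: Rinj; rewrite /= -rhoP Psi1 mulmx1 mul1mx.
split=> [|X stX]; first by rewrite lt0n mxrank_eq0.
pose L := <<kermx X *m R>>%MS.
have stL : stable Psi L.
  move=> f; rewrite (eqmxMr _ (genmxE _)) genmxE -mulmxA rhoP mulmxA submxMr //.
  apply/sub_kermxP; have /submxP[D] := stX f.
  move/(congr1 trmx); rewrite trmxK trmx_mul trmxK => XD.
  by rewrite -mulmxA XD mulmxA mulmx_ker mul0mx.
have rL : \rank L = \rank (kermx X).
  by rewrite genmxE mxrankMfree.
have [L0|L0] := eqVneq L 0.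
  right; apply/eqP; rewrite eqn_leq rank_leq_row /=.
  by move: rL; rewrite L0 mxrank0 mxrank_ker => /esym/eqP; rewrite subn_eq0.
left; have : (\rank K' <= \rank L)%N.
  apply: mxrankS; apply: minK' => //.
  by rewrite genmxE -eqR submxMl.
rewrite rL mxrank_ker; have := rank_leq_row X; move: (\rank K') (\rank X) => a b.
by case: b => // b ba; rewrite leqNgt ltn_subrL (leq_trans _ ba).
Qed.

Lemma irreducible_rows p k (psi : V -> 'M[C]_p) (K : 'M[C]_(k, p)) :
  irreducible psi -> stable psi K -> K != 0 -> row_full K.
Proof.
move=> [_ irr] stK K0; pose X := (kermx K^T)^T.
have KX : K *m X = 0 by rewrite -[K]trmxK -trmx_mul mulmx_ker trmx0.
have [|r0|rp] := irr X; first 1 last.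
- move: r0; rewrite mxrank_tr mxrank_ker mxrank_tr => /eqP; rewrite subn_eq0 => pr.
  by rewrite /row_full eqn_leq pr rank_leq_col.
- have Xf : row_free X by rewrite /row_free rp.
  by case/eqP: K0; apply: (row_free_inj Xf); rewrite KX mul0mx.
move=> f; rewrite trmxK; apply/sub_kermxP; have /submxP[D KD] := stK f.
by rewrite -trmx_mul mulmxA KD -mulmxA KX mulmx0 trmx0.
Qed.

Lemma Schur_rank p q (psi : V -> 'M[C]_p) (rho : V -> 'M[C]_q) (P : 'M[C]_(p, q)) :
    irreducible psi -> irreducible rho ->
    (forall f, psi f *m P = P *m rho f) -> P != 0 ->
  \rank P = p /\ \rank P = q.
Proof.
move=> [_ irr1] irr2 PI P0; split.
  have [|r0|] := irr1 (<<P^T>>%MS)^T; last first.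
  - by rewrite mxrank_tr genmxE mxrank_tr.
  - by move: r0; rewrite mxrank_tr genmxE mxrank_tr => /eqP; rewrite mxrank_eq0 (negPf P0).
  move=> f; rewrite trmx_mul !trmxK (eqmxMr _ (genmxE _)) genmxE.
  by rewrite -trmx_mul PI trmx_mul submxMl.
apply/eqP; apply: irreducible_rows irr2 _ P0 => f.
by rewrite -PI submxMl.
Qed.

Lemma Schur p q (psi : V -> 'M[C]_p) (rho : V -> 'M[C]_q) (P : 'M[C]_(p, q)) :
    irreducible psi -> irreducible rho ->
    (forall f, psi f *m P = P *m rho f) -> P != 0 -> rep_iso psi rho.
Proof.
move=> irr1 irr2 PI P0; have [r1 r2] := Schur_rank irr1 irr2 PI P0.
have epq : p = q by rewrite -r1.
subst q; have Pu : P \in unitmx by rewrite -row_free_unit /row_free r1.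
by exists P, (invmx P); split; [rewrite mulmxV | rewrite mulVmx |].
Qed.

End Representations.

Lemma Schur_scalar (C : numClosedFieldType) n p (psi : 'rV[C]_n -> 'M[C]_p) (P : 'M[C]_p) :
    irreducible psi -> (forall f, psi f *m P = P *m psi f) ->
  exists c, P = c%:M.
Proof.
move=> irr PI; have [p0 _] := irr.
have [c /eigenvalueP [v vP v0]] := eigenvalue_closed P p0.
exists c; apply/eqP; rewrite -subr_eq0; apply/negPn/negP => Pc0.
have PIc f : psi f *m (P - c%:M) = (P - c%:M) *m psi f.
  by rewrite mulmxBr mulmxBl PI scalar_mxC.
have [r _] := Schur_rank irr irr PIc Pc0.
have Pf : row_free (P - c%:M) by rewrite /row_free r.
case/eqP: v0; apply: (row_free_inj Pf).
by rewrite mul0mx mulmxBr vP mul_mx_scalar subrr.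
Qed.

(** * Wedderburn decomposition of the dual *)

Section Wedderburn.
Variables (C : numClosedFieldType) (n : nat) (H : wha C n).
Variables (I : finType) (m : I -> nat) (psi : forall a : I, 'rV[C]_n -> 'M[C]_(m a)).
Hypotheses (whaH : is_wha H) (ssH : semisimple (dmul H)) (irrH : irrep_family H psi).
Local Notation V := 'rV[C]_n.
Local Notation e_ := (@bvec C n).

Lemma psi_irr a : irreducible (psi a).
Proof. by case: irrH => /(_ a) []. Qed.

Lemma psi_gt0 a : (0 < m a)%N.
Proof. by case: (psi_irr a). Qed.

Lemma lin_psi a : lin (psi a).
Proof. by case: irrH => /(_ a) [[]]. Qed.

Lemma psiM a f g : psi a (dmulH H f g) = psi a f *m psi a g.
Proof. by case: irrH => /(_ a) [[]]. Qed.

Lemma psi1 a : psi a (weps H) = 1%:M.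
Proof. by case: irrH => /(_ a) [[]]. Qed.

Lemma lin_mx_entry p q (i : 'I_p) (j : 'I_q) : lin (fun A : 'M[C]_(p, q) => A i j : C^o).
Proof. by move=> c A B; rewrite !mxE. Qed.

Lemma lin_mxtrace p : lin (@mxtrace C p : 'M[C]_p -> C^o).
Proof. by move=> c A B; rewrite linearP. Qed.

Lemma quotient_irrep q (Psi : V -> 'M[C]_q) (K : 'M[C]_q) :
    drep H Psi -> K != 0 -> stable Psi K ->
  exists c (P : 'M[C]_(m c, q)),
    [/\ P != 0, (P <= K)%MS & forall f, P *m Psi f = psi c f *m P].
Proof.
move=> PsiH K0 stK.
have [p [rho [R [rhoH rho_irr Rfree sRK Rrho]]]] := irreducible_cut PsiH K0 stK.
have [_ _ /(_ p rho rhoH rho_irr) [c [P [Q [PQ QP PI]]]]] := irrH.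
exists c, (P *m R); split.
- apply/eqP => PR0; have R0 : R = 0 by rewrite -[R]mul1mx -QP -mulmxA PR0 mulmx0.
  have [p0 _] := rho_irr; move: Rfree; rewrite R0 /row_free mxrank0 => /eqP E.
  by rewrite -E in p0.
- by rewrite mulmx_sub.
- by move=> f; rewrite -mulmxA Rrho !mulmxA PI.
Qed.

Definition regular (f : V) : 'M[C]_n := \matrix_(i, j) dmulH H f (e_ j) 0 i.

Lemma lin_dmulHr f : lin (dmulH H f).
Proof.
move=> c g h; apply: ev_inj => x; rewrite lin_evl !ev_dmulH.
have l : lin (fun g => sweedler H x (fun a b => ev f a * ev g b : C^o)).
  by apply: lin_swr => a b c' z z'; rewrite lin_evl /GRing.scale /=; ring.
exact: l.
Qed.

Lemma lin_dmulHl g : lin (fun f => dmulH H f g).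
Proof.
move=> c f h; apply: ev_inj => x; rewrite lin_evl !ev_dmulH.
have l : lin (fun f => sweedler H x (fun a b => ev f a * ev g b : C^o)).
  by apply: lin_swr => a b c' z z'; rewrite lin_evl /GRing.scale /=; ring.
exact: l.
Qed.

Lemma regularE f u : regular f *m u^T = (dmulH H f u)^T.
Proof.
apply/colP => i; rewrite !mxE (lin_bvec u (lin_dmulHr f)) summxE.
by apply: eq_bigr => j _; rewrite !mxE mulrC.
Qed.

Lemma mulmx_trmx_inj p q (A B : 'M[C]_(p, q)) :
  (forall u : 'rV[C]_q, A *m u^T = B *m u^T) -> A = B.
Proof.
move=> AB; apply/matrixP => i j; have := AB (delta_mx 0 j).
by rewrite trmx_delta -!colE => /colP /(_ i); rewrite !mxE.
Qed.

Lemma regular_drep : drep H regular.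
Proof.
split=> [c f g|f g|]; apply: mulmx_trmx_inj => u.
- by rewrite mulmxDl -scalemxAl !regularE lin_dmulHl linearP.
- by rewrite -mulmxA !regularE dmulHA.
- by rewrite regularE dmul1H // mul1mx.
Qed.

Definition mcoef := {a : I & ('I_(m a) * 'I_(m a))%type}.

(** The matrix of f |-> (psi_a(f))_a, all entries flattened into one index. The left kernel of its
    transpose is the common kernel of the irreducibles; its row freeness is the independence of all
    matrix coefficients. *)
Definition coefmx : 'M[C]_(#|{: mcoef}|, n) :=
  \matrix_(s, l) psi (tag (enum_val s)) (e_ l) (tagged (enum_val s)).1 (tagged (enum_val s)).2.

Lemma coefmxE f s : (f *m coefmx^T) 0 s
  = psi (tag (enum_val s)) f (tagged (enum_val s)).1 (tagged (enum_val s)).2.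
Proof.
have l := lin_comp (lin_mx_entry (tagged (enum_val s)).1 (tagged (enum_val s)).2)
  (@lin_psi (tag (enum_val s))).
by rewrite (lin_bvec f l) !mxE; apply: eq_bigr => i _; rewrite !mxE.
Qed.

Lemma coefmx_eq0 f : f *m coefmx^T = 0 <-> forall a, psi a f = 0.
Proof.
split=> [f0 a|f0]; last by apply/rowP => s; rewrite coefmxE f0 !mxE.
apply/matrixP => i j; pose x : mcoef := Tagged _ (i, j).
have /rowP /(_ (enum_rank x)) := f0; rewrite coefmxE enum_rankK /= => ->.
by rewrite !mxE.
Qed.

(* The common kernel J of the irreducibles has a complementary left ideal W; an
   irreducible quotient of the regular module B/W would be killed by J + W. *)
Lemma psi_separating f : (forall a, psi a f = 0) -> f = 0.
Proof.
pose J : 'M[C]_n := kermx coefmx^T.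
have JP u : (u <= J)%MS <-> forall a, psi a u = 0.
  by rewrite -coefmx_eq0; split=> /sub_kermxP.
have Jideal : left_ideal (dmul H) J.
  by move=> g u /JP u0; apply/JP => a; rewrite [LHS]psiM u0 mulmx0.
have [W [Wideal JW0 JW1]] := ssH Jideal.
suff J0 : J = 0 by move/JP; rewrite J0 submx0 => /eqP.
suff W1 : row_full W.
  apply/eqP; rewrite -submx0 -(eqmxP JW0) sub_capmx submx_refl.
  exact: submx_full.
pose K : 'M[C]_n := kermx W^T.
suff K0 : K = 0.
  have := mxrank_ker W^T; rewrite -/K K0 mxrank0 mxrank_tr => /esym/eqP.
  by rewrite subn_eq0 /row_full eqn_leq rank_leq_row.
apply/eqP/negPn/negP => K0.
have stK : stable regular K.
  move=> g; apply/sub_kermxP.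
  have /submxP[D WD] : ((regular g *m W^T)^T <= W)%MS.
    apply/row_subP => i; rewrite -tr_col colE -mulmxA -colE -tr_row regularE trmxK.
    by apply: Wideal; apply: row_sub.
  have -> : K *m regular g *m W^T = K *m W^T *m D^T.
    by rewrite -!mulmxA -[regular g *m _]trmxK WD trmx_mul.
  by rewrite mulmx_ker mul0mx.
have [c [P [P0 PK Preg]]] := quotient_irrep regular_drep K0 stK.
have PW : P *m W^T = 0 by apply/sub_kermxP.
have PJ : P *m J^T = 0.
  apply/matrixP => i j; have : P *m (row j J)^T = 0.
    rewrite -(dmulH1 whaH (row j J)) -regularE mulmxA Preg.
    by have /JP -> := row_sub j J; rewrite !mul0mx.
  by rewrite tr_row colE mulmxA -colE => /colP /(_ i); rewrite !mxE.
case/eqP: P0; apply: mulmx_trmx_inj => u; rewrite mul0mx.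
have : (u <= J + W)%MS by rewrite (eqmxP JW1) submx1.
case/sub_addsmxP => [[x y]] /= ->.
by rewrite linearD /= mulmxDr (trmx_mul x J) (trmx_mul y W) !mulmxA PJ PW !mul0mx addr0.
Qed.

(** The density theorem, by a relation of minimal support. If (a0, j0) lies in the support, sending
    x_{a0 j0} psi_{a0}(g) to x_{aj} psi_a(g) is a well defined intertwiner, so by Schur the other
    rows vanish for a != a0 and are multiples of x_{a0 j0} for a = a0. The relation then contradicts
    the fact that the rows x_{a0 j0} psi_{a0}(f) span. *)
Lemma matrix_rows_free (x : forall a, 'I_(m a) -> 'rV[C]_(m a)) :
    (forall f, \sum_a \sum_j (x a j *m psi a f) 0 j = 0) ->
  forall a j, x a j = 0.
Proof.
pose supp (y : forall a, 'I_(m a) -> 'rV[C]_(m a)) :=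
  [set s : {a : I & 'I_(m a)} | y (tag s) (tagged s) != 0].
have [N] := ubnP #|supp x|; elim: N x => // N IHN x ltN rel a0 j0.
apply/eqP/negPn/negP => x0.
(* Multiplying the relation by g gives another relation, whose support has lost (a0, j0); by
   induction it is trivial. This is the well-definedness of the intertwiner [Phi]. *)
have shrink g : x a0 j0 *m psi a0 g = 0 -> forall a j, x a j *m psi a g = 0.
  move=> g0; apply: (IHN (fun a j => x a j *m psi a g)) => [|f].
    apply: (@leq_trans #|supp x|); last exact: ltN.
    apply: proper_card; apply/properP; split.
      apply/subsetP => s; rewrite !inE; apply: contra_neq => ->.
      by rewrite mul0mx.
    by exists (Tagged (fun a => 'I_(m a)) j0); rewrite !inE //= g0 eqxx.
  rewrite -[RHS](rel (dmulH H g f)); do 2!apply: eq_bigr => ? _.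
  by rewrite psiM mulmxA.
pose G a j : 'M[C]_(n, m a) := \matrix_i (x a j *m psi a (e_ i)).
have GE a j u : u *m G a j = x a j *m psi a u.
  have l : lin (fun u => x a j *m psi a u).
    by move=> c y z; rewrite lin_psi mulmxDr scalemxAr.
  rewrite (lin_bvec u l) mulmx_sum_row; apply: eq_bigr => i _.
  by rewrite rowK.
pose Rm f : 'M[C]_n := \matrix_i dmulH H (e_ i) f.
have Gpsi a j f : G a j *m psi a f = Rm f *m G a j.
  by apply/row_matrixP => i; rewrite !row_mul !rowK GE psiM mulmxA.
have G1 a j : weps H *m G a j = x a j by rewrite GE psi1 mulmx1.
have G0full : row_full (G a0 j0).
  apply: (irreducible_rows (psi_irr a0)) => [f|]; first by rewrite Gpsi submxMl.
  by apply: contra_neq x0 => G0; rewrite -G1 G0 mulmx0.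
pose Phi a j := pinvmx (G a0 j0) *m G a j.
have GPhi a j : G a0 j0 *m Phi a j = G a j.
  apply/eqP; rewrite -subr_eq0 mulmxA -[X in _ - X]mul1mx -mulmxBl; apply/eqP.
  apply/row_matrixP => i; rewrite row_mul GE row0 shrink // -GE -row_mul mulmxBl.
  by rewrite mulmxKpV // mul1mx subrr row0.
clearbody Phi.
have PhiI a j f : psi a0 f *m Phi a j = Phi a j *m psi a f.
  apply: (row_full_inj G0full); rewrite /= [RHS]mulmxA GPhi [LHS]mulmxA.
  by rewrite !Gpsi -mulmxA GPhi.
have xPhi a j : x a j = x a0 j0 *m Phi a j by rewrite -(G1 a j) -GPhi mulmxA G1.
have off a j : a != a0 -> x a j = 0.
  move=> ne; rewrite xPhi; have [->|P0] := eqVneq (Phi a j) 0; first by rewrite mulmx0.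
  have [_ noniso _] := irrH; case: (noniso a0 a); first by rewrite eq_sym.
  exact: Schur (psi_irr _) (psi_irr _) (PhiI a j) P0.
have /fin_all_exists [lam lamP] j : exists c, x a0 j = c *: x a0 j0.
  have [c Pc] := Schur_scalar (psi_irr a0) (PhiI a0 j).
  by exists c; rewrite xPhi Pc mul_mx_scalar.
(* The relation now says that the column of the scalars [lam] is killed by every row x_{a0 j0}
   psi_{a0}(f). *)
pose y : 'cV[C]_(m a0) := \col_j lam j.
have : y = 0.
  apply: (row_full_inj G0full); rewrite mulmx0; apply/row_matrixP => i.
  rewrite row_mul rowK row0; apply/rowP => k; rewrite !ord1.
  have := rel (e_ i); rewrite (bigD1 a0) //= [X in _ + X]big1 ?addr0 => [|a ne]; last first.
    by rewrite big1 // => j _; rewrite off // mul0mx mxE.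
  move=> rel0; rewrite [RHS]mxE -[RHS]rel0 mxE; apply: eq_bigr => j _.
  by rewrite (lamP j) -scalemxAl [RHS]mxE mulrC; congr (_ * _); rewrite mxE.
move/colP/(_ j0); rewrite !mxE => lam0.
by move: x0; rewrite lamP lam0 scale0r eqxx.
Qed.

Lemma mcoef_free (X : forall a, 'M[C]_(m a)) :
  (forall f, \sum_a \tr (X a *m psi a f) = 0) -> forall a, X a = 0.
Proof.
move=> rel a; apply/row_matrixP => j; rewrite row0.
apply: (@matrix_rows_free (fun a j => row j (X a))) => f.
rewrite -[RHS](rel f); apply: eq_bigr => b _; apply: eq_bigr => i _.
by rewrite -row_mul mxE.
Qed.

Lemma coefmx_free : row_free coefmx.
Proof.
rewrite -kermx_eq0; apply/eqP/row_matrixP => i; rewrite row0.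
set y := row i _; have yG : y *m coefmx = 0 by rewrite -row_mul mulmx_ker row0.
pose tg a (ij : 'I_(m a) * 'I_(m a)) : mcoef := Tagged (fun a => ('I_(m a) * 'I_(m a))%type) ij.
(* The index pair is transposed so that the sum over entries becomes a trace. *)
pose X a : 'M[C]_(m a) := \matrix_(p, q) y 0 (enum_rank (tg a (q, p))).
have X0 a : X a = 0.
  apply: mcoef_free a => f.
  transitivity ((y *m (f *m coefmx^T)^T) 0 0); last first.
    by rewrite trmx_mul trmxK mulmxA yG mul0mx mxE.
  pose F (s : mcoef) := y 0 (enum_rank s) * psi (tag s) f (tagged s).1 (tagged s).2.
  transitivity (\sum_s F s); last first.
    rewrite (reindex (fun s : 'I_#|{: mcoef}| => enum_val s)) /=; last exact/onW_bij/enum_val_bij.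
    by rewrite mxE; apply: eq_bigr => s _; rewrite [X in _ * X]mxE coefmxE /F enum_valK.
  transitivity (\sum_b \sum_(ij : 'I_(m b) * 'I_(m b)) F (tg b ij)); last first.
    by rewrite (sig_big_dep xpredT (fun _ => xpredT)); apply: eq_bigr => -[].
  apply: eq_bigr => b _; transitivity (\sum_q \sum_p F (tg b (q, p))); last first.
    by rewrite pair_bigA; apply: eq_bigr => -[].
  rewrite exchange_big; apply: eq_bigr => p _; rewrite mxE; apply: eq_bigr => q _.
  by rewrite mxE.
apply/rowP => s; have /matrixP /(_ (tagged (enum_val s)).2 (tagged (enum_val s)).1) :=
  X0 (tag (enum_val s)).
rewrite !mxE /tg -surjective_pairing; case E: (enum_val s) => [a ij] /= ys.
by rewrite -[s]enum_valK E ys.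
Qed.

Lemma psi_surjective (X : forall a, 'M[C]_(m a)) : exists f, forall a, psi a f = X a.
Proof.
have /row_freeP [B GB] := coefmx_free.
pose z : 'cV[C]_(#|{: mcoef}|) :=
  \col_s X (tag (enum_val s)) (tagged (enum_val s)).1 (tagged (enum_val s)).2.
exists (B *m z)^T => a; apply/matrixP => i j.
pose x : mcoef := Tagged _ (i, j); have := coefmxE (B *m z)^T (enum_rank x).
by rewrite enum_rankK /= => <-; rewrite -trmx_mul mulmxA GB mul1mx !mxE enum_rankK.
Qed.

End Wedderburn.

(** * Matrix coefficients *)

Section Tensor.
Variable C : fieldType.

Lemma big_mxtens p q (F : 'I_(p * q) -> C) :
  \sum_k F k = \sum_i \sum_j F (mxtens_index (i, j)).
Proof.
rewrite pair_bigA (reindex (@mxtens_index p q)) /=; first by apply: eq_bigr => -[].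
by exists (@mxtens_unindex p q) => k _; rewrite ?mxtens_indexK ?mxtens_unindexK.
Qed.

Lemma mxtrace_tens p q (A : 'M[C]_p) (B : 'M[C]_q) : \tr (A *t B) = \tr A * \tr B.
Proof.
rewrite /mxtrace big_mxtens mulr_suml; apply: eq_bigr => i _.
by rewrite mulr_sumr; apply: eq_bigr => j _; rewrite tensmxE.
Qed.

Lemma tens_delta p q (i i' : 'I_p) (j j' : 'I_q) :
  delta_mx (mxtens_index (i, j)) (mxtens_index (i', j')) = delta_mx i i' *t delta_mx j j' :> 'M[C]__.
Proof.
apply/matrixP => k l; case: (mxtens_indexP k) => a b; case: (mxtens_indexP l) => a' b'.
rewrite tensmxE !mxE !(inj_eq (can_inj (@mxtens_indexK _ _))) !xpair_eqE -natrM mulnb.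
by congr (_%:R); case: eqP; case: eqP; case: eqP; case: eqP.
Qed.

Lemma lin_tens0 (U : lmodType C) p q (F : 'M[C]_(p * q) -> U) :
  lin F -> (forall X Y, F (X *t Y) = 0) -> forall M, F M = 0.
Proof.
move=> F_lin F0 M; rewrite (matrix_sum_delta M) (lin_sum F_lin) big1 // => k _.
rewrite (lin_sum F_lin) big1 // => l _; rewrite (linZ F_lin).
case: (mxtens_indexP k) => a b; case: (mxtens_indexP l) => a' b'.
by rewrite tens_delta F0 scaler0.
Qed.

Lemma mxtrace_delta_mul p (i j : 'I_p) (A : 'M[C]_p) : \tr (delta_mx i j *m A) = A j i.
Proof.
rewrite mxtrace_mulC /mxtrace (bigD1 j) //= big1 ?addr0 => [|k ne].
  rewrite mxE (bigD1 i) //= big1 ?addr0 => [|k ne]; rewrite mxE !eqxx ?mulr1 //.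
  by rewrite (negPf ne) mulr0.
by rewrite mxE big1 // => h _; rewrite mxE (negPf ne) andbF mulr0.
Qed.

Lemma mxtrace_inj p (A B : 'M[C]_p) : (forall X, \tr (X *m A) = \tr (X *m B)) -> A = B.
Proof. by move=> AB; apply/matrixP => i j; rewrite -!(mxtrace_delta_mul j i). Qed.

Lemma mul_delta_entry p q s t (A : 'M[C]_(p, q)) (B : 'M[C]_(s, t)) i j k h :
  (A *m delta_mx i j *m B) k h = A k i * B j h.
Proof.
rewrite -(mul_delta_mx (0 : 'I_1)) mulmxA -mulmxA -colE -rowE mxE big_ord1.
by rewrite !mxE.
Qed.

End Tensor.

Section MatrixCoefficients.
Variables (C : numClosedFieldType) (n : nat) (H : wha C n).
Variables (I : finType) (m : I -> nat) (psi : forall a : I, 'rV[C]_n -> 'M[C]_(m a)).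
Hypotheses (whaH : is_wha H) (ssH : semisimple (dmul H)) (irrH : irrep_family H psi).
Local Notation V := 'rV[C]_n.
Local Notation "x ** y" := (mulH H x y) (at level 40, left associativity).
Local Notation S := (SH H).
Local Notation one := (wone H).
Local Notation eps := (epsH H).
Local Notation e_ := (@bvec C n).
Local Notation sw := (sweedler H).
Local Notation mulHA := (mulHA whaH).
Local Notation linr := (@lin_mulHr _ _ H _).
Local Notation linl := (@lin_mulHl _ _ H _).
Implicit Types (x y z f g : V).

(* The element of A = B^* given by f |-> Tr (X psi_a(f)). *)
Definition mc a (X : 'M[C]_(m a)) : V := \row_i \tr (X *m psi a (e_ i)).

Lemma ev_mc f a X : ev f (@mc a X) = \tr (X *m psi a f).
Proof.
have l : lin (fun f => \tr (X *m psi a f) : C^o).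
  by move=> c g h; rewrite (lin_psi irrH) mulmxDr -scalemxAr lin_mxtrace.
rewrite (lin_bvec f l); apply: eq_bigr => i _; rewrite mxE //.
Qed.

Lemma lin_mc a : lin (@mc a).
Proof.
move=> c X Y; apply: ev_injr => f; rewrite lin_ev !ev_mc.
by rewrite mulmxDl -scalemxAl lin_mxtrace.
Qed.

Lemma eps_mc a X : eps (@mc a X) = \tr X.
Proof. by rewrite /epsH ev_mc (psi1 irrH) mulmx1. Qed.

Lemma mc_inj (X Y : forall a, 'M[C]_(m a)) :
  \sum_a mc (X a) = \sum_a mc (Y a) -> forall a, X a = Y a.
Proof.
move=> XY a; apply/eqP; rewrite -subr_eq0; apply/eqP.
apply: (mcoef_free irrH (X := fun a => X a - Y a)) => f.
have /(congr1 (ev f : V -> C^o)) := XY; rewrite !(lin_sum (@lin_ev _ _ f)) /= => E.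
apply/eqP; under eq_bigr do rewrite mulmxBl linearB /= -!ev_mc.
by rewrite sumrB E subrr.
Qed.

Lemma mc0 a : mc (0 : 'M_(m a)) = 0.
Proof. exact: (lin0 (@lin_mc a)). Qed.

Lemma mc_eq0 (X : forall a, 'M[C]_(m a)) : \sum_a mc (X a) = 0 -> forall a, X a = 0.
Proof.
move=> X0; apply: (mc_inj (Y := fun a => 0)); rewrite X0 big1 // => a _.
exact: mc0.
Qed.

Lemma psi_eq f g : (forall a X, ev f (@mc a X) = ev g (mc X)) -> f = g.
Proof.
move=> fg; apply/eqP; rewrite -subr_eq0; apply/eqP; apply: (psi_separating whaH ssH irrH) => a.
apply/eqP; rewrite -scaleN1r addrC (lin_psi irrH) scaleN1r addrC subr_eq0; apply/eqP.
by apply: mxtrace_inj => X; rewrite -!ev_mc.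
Qed.

(** The family supported at a alone; it reduces statements about one or two matrix coalgebras to
    [mc_inj], which speaks of whole families. *)
Definition single a X b : 'M[C]_(m b) :=
  if a =P b is ReflectT e then castmx (congr1 m e, congr1 m e) X else 0.

Lemma single_id a X : single X a = X :> 'M[C]_(m a).
Proof.
rewrite /single; case: eqP => // e; rewrite (eq_irrelevance (congr1 m e) erefl).
by rewrite castmx_id.
Qed.

Lemma single_ne a b (X : 'M[C]_(m a)) : b != a -> single X b = 0.
Proof. by move=> ne; rewrite /single; case: eqP => // e; rewrite e eqxx in ne. Qed.

Lemma mc_single a (X : 'M[C]_(m a)) : \sum_b mc (single X b) = mc X.
Proof.
rewrite (bigD1 a) //= single_id big1 ?addr0 // => b ne; rewrite single_ne // mc0 //.
Qed.

Lemma mc_disjoint a b (X : 'M[C]_(m a)) (Y : 'M[C]_(m b)) : a != b -> mc X = mc Y -> X = 0.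
Proof.
move=> ne E; rewrite -[X]single_id.
have := mc_inj (X := single X) (Y := single Y); rewrite !mc_single => /(_ E a) ->.
exact: single_ne.
Qed.

Lemma mc_inj1 a (X Y : 'M[C]_(m a)) : mc X = mc Y -> X = Y.
Proof.
move=> E; rewrite -[X]single_id -[Y]single_id; apply: (mc_inj (X := single X) (Y := single Y)).
by rewrite !mc_single.
Qed.

(** Dual to Tr (X psi_a(f) psi_a(g)), expanded as a sum over entries (i, j) of X psi_a(f) times
    entries (j, i) of psi_a(g). *)
Lemma sw_mc (U : lmodType C) a (X : 'M[C]_(m a)) (F : V -> V -> U) :
    (forall b, lin (F^~ b)) -> (forall a, lin (F a)) ->
  sw (mc X) F = \sum_i \sum_j F (mc (delta_mx j i *m X)) (mc (delta_mx i j)).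
Proof.
move=> Fl Fr.
have D p q : Delta H (mc X) p q = \tr (X *m psi a (e_ p) *m psi a (e_ q)).
  rewrite -mulmxA -(psiM irrH) -ev_mc -ev_Delta (bigD1 p) //= (bigD1 q) //= !mxE !eqxx.
  rewrite !big1 ?addr0 ?mul1r ?mulr1 // => [i' /negPf ne|j' /negPf ne].
    by rewrite big1 // => j' _; rewrite !mxE ne !mul0r.
  by rewrite !mxE ne andbF !mulr0.
transitivity (\sum_i \sum_j \sum_p \sum_q
    ((X *m psi a (e_ p)) i j * psi a (e_ q) j i) *: F (e_ p) (e_ q)); last first.
  do 2!apply: eq_bigr => ? _; rewrite (lin_bvec (mc _) (Fl _)); apply: eq_bigr => p _.
  rewrite (lin_bvec (mc _) (Fr _)) scaler_sumr; apply: eq_bigr => q _.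
  by rewrite scalerA !mxE -!mulmxA !mxtrace_delta_mul !mxE.
rewrite /sweedler.
under [RHS]eq_bigr do rewrite exchange_big /=.
rewrite [RHS]exchange_big /=; apply: eq_bigr => p _.
under [RHS]eq_bigr do rewrite exchange_big /=.
rewrite [RHS]exchange_big /=; apply: eq_bigr => q _.
rewrite D /mxtrace scaler_suml; apply: eq_bigr => i _; rewrite mxE scaler_suml.
by [].
Qed.

Definition inA a x := exists X : 'M[C]_(m a), x = mc X.

Lemma inA_mc a X : inA a (@mc a X).
Proof. by exists X. Qed.

Lemma inA_scale a c x : inA a x -> inA a (c *: x).
Proof. by move=> [X ->]; exists (c *: X); rewrite (linZ (@lin_mc a)). Qed.

Lemma inA_sum a (J : finType) (F : J -> V) : (forall i, inA a (F i)) -> inA a (\sum_i F i).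
Proof.
move=> FA; apply: big_ind => [|x y [X ->] [Y ->]|//]; first by exists 0; rewrite mc0.
by exists (X + Y); rewrite (linD (@lin_mc a)).
Qed.

End MatrixCoefficients.

(** * Fusion *)

Section Fusion.
Variables (C : numClosedFieldType) (n : nat) (H : wha C n).
Variables (I : finType) (m : I -> nat) (psi : forall a : I, 'rV[C]_n -> 'M[C]_(m a)).
Variables (N : I -> I -> I -> nat)
  (Vt : forall a b c, 'I_(N a b c) -> 'M[C]_(m a * m b, m c))
  (Wt : forall a b c, 'I_(N a b c) -> 'M[C]_(m c, m a * m b))
  (bv : forall a, 'M[C]_(m a)) (u : forall a, 'rV[C]_(m a))
  (v : forall a, 'cV[C]_(m a)) (l r : I -> I)
  (bar : I -> I) (hbar : forall a, bar (bar a) = a)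
  (Z : forall a, 'M[C]_(m a, m (bar a))) (Zi : forall a, 'M[C]_(m (bar a), m a)).
Hypotheses (whaH : is_wha H) (ssH : semisimple (dmul H)) (irrH : irrep_family H psi)
  (fusH : fusion H psi Vt Wt) (vacH : vacuum H psi N bv u v l r)
  (conjH : conjugation H psi Z Zi).
Local Notation V := 'rV[C]_n.
Local Notation "x ** y" := (mulH H x y) (at level 40, left associativity).
Local Notation S := (SH H).
Local Notation one := (wone H).
Local Notation eps := (epsH H).
Local Notation e_ := (@bvec C n).
Local Notation sw := (sweedler H).
Local Notation mulHA := (mulHA whaH).
Local Notation linr := (@lin_mulHr _ _ H _).
Local Notation linl := (@lin_mulHl _ _ H _).
Local Notation mc := (mc psi).
Local Notation inA := (inA psi).
Implicit Types (x y z f g : V).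

(** The channel c of the fusion decomposition, transposed under the trace pairing: it describes
    multiplication in A on coefficient matrices. *)
Definition fus a b c (M : 'M[C]_(m a * m b)) : 'M[C]_(m c) :=
  \sum_(mu < N a b c) Wt mu *m M *m Vt mu.

Lemma lin_fus a b c : lin (@fus a b c).
Proof.
move=> k A B; rewrite /fus scaler_sumr -big_split; apply: eq_bigr => mu _ /=.
by rewrite mulmxDr mulmxDl -scalemxAr -scalemxAl.
Qed.

Lemma mc_mul a b (X : 'M_(m a)) (Y : 'M_(m b)) :
  mc X ** mc Y = \sum_c mc (fus c (X *t Y)).
Proof.
have [Dfus _ _] := fusH; apply: ev_injr => f; rewrite [RHS](lin_sum (@lin_ev _ _ f)) /=.
transitivity (\tr ((X *t Y) *m tensrep (psi a) (psi b) (dDelta H f))).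
  rewrite ev_mulH /tensrep mulmx_sumr (lin_sum (@lin_mxtrace _ _)).
  apply: eq_bigr => i _; rewrite mulmx_sumr (lin_sum (@lin_mxtrace _ _)).
  apply: eq_bigr => j _; rewrite -scalemxAr (linZ (@lin_mxtrace _ _)) tensmx_mul.
  by rewrite mxtrace_tens ![mc _ _ _]mxE.
rewrite Dfus mulmx_sumr (lin_sum (@lin_mxtrace _ _)); apply: eq_bigr => c _.
rewrite (ev_mc irrH) /fus mulmx_sumr mulmx_suml !(lin_sum (@lin_mxtrace _ _)).
by apply: eq_bigr => mu _; rewrite !mulmxA mxtrace_mulC !mulmxA.
Qed.

Lemma fus_VW a b c (mu : 'I_(N a b c)) (P : 'M_(m c)) : fus c (Vt mu *m P *m Wt mu) = P.
Proof.
have [_ WV _] := fusH; rewrite /fus (bigD1 mu) //= big1 ?addr0 => [|nu ne].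
  by rewrite !mulmxA WV eqxx mul1mx -mulmxA WV eqxx mulmx1.
by rewrite !mulmxA WV (negPf ne) mul_scalar_mx scale0r !mul0mx.
Qed.

Lemma fus_VW0 a b c d (mu : 'I_(N a b c)) (P : 'M_(m c)) :
  d != c -> fus d (Vt mu *m P *m Wt mu) = 0.
Proof.
have [_ _ WV] := fusH => ne; rewrite /fus big1 // => nu _.
by rewrite !mulmxA WV // !mul0mx.
Qed.

Lemma one_neq0_mx a : (1%:M : 'M[C]_(m a)) != 0.
Proof.
have := psi_gt0 irrH a; case: (m a) => // k _.
by apply/eqP => /matrixP /(_ 0 0) /eqP; rewrite !mxE eqxx oner_eq0.
Qed.

(** Elementary tensors span, and a channel mu would give V_mu W_mu, on which [fus c] is the
    identity. In this way vanishing of products in A becomes vanishing of multiplicities. *)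
Lemma fus_eq0 a b c : (forall X Y, fus c (X *t Y : 'M_(m a * m b)) = 0) -> N a b c = 0%N.
Proof.
move=> f0; apply/eqP; case E: (N a b c) => [//|N'].
have mu : 'I_(N a b c) by rewrite E; exact: ord0.
have := lin_tens0 (@lin_fus a b c) f0 (Vt mu *m 1%:M *m Wt mu).
by rewrite fus_VW => /eqP; rewrite (negPf (one_neq0_mx c)).
Qed.

Lemma fus_N0 a b c M : N a b c = 0%N -> @fus a b c M = 0.
Proof. by move=> N0; rewrite /fus big1 // => mu; have := ltn_ord mu; rewrite {2}N0. Qed.

(** The component of 1 in the matrix coalgebra of e. The nonzero ones act as orthogonal idempotents
    cutting A into pieces with given l and r. *)
Definition beta e := mc (bv e).

Lemma sum_beta : \sum_e beta e = one.
Proof.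
have [b1 _ _ _] := vacH; apply: ev_injr => f; rewrite b1 (lin_sum (@lin_ev _ _ f)) /=.
by apply: eq_bigr => e _; rewrite (ev_mc irrH).
Qed.

Lemma beta0 e : bv e = 0 -> beta e = 0.
Proof. by move=> b0; rewrite /beta b0 (mc0 irrH). Qed.

Lemma beta_mull e a (X : 'M_(m a)) : e != l a -> beta e ** mc X = 0.
Proof.
move=> ne; have [b0|b0] := eqVneq (bv e) 0; first by rewrite beta0 // (lin0 linl).
have [_ _ /(_ a) [_ Nl] _] := vacH.
rewrite /beta mc_mul big1 // => c _; rewrite fus_N0 ?(mc0 irrH) //.
by rewrite Nl // (negPf ne).
Qed.

Lemma beta_l a (X : 'M_(m a)) : beta (l a) ** mc X = mc X.
Proof.
rewrite -[RHS](mul1H whaH) -sum_beta (lin_sum linl) (bigD1 (l a)) //= big1 ?addr0 // => e ne.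
exact: beta_mull.
Qed.

Lemma beta_mulr e a (X : 'M_(m a)) : e != r a -> mc X ** beta e = 0.
Proof.
move=> ne; have [b0|b0] := eqVneq (bv e) 0; first by rewrite beta0 // (lin0 linr).
have [_ _ _ /(_ a) [_ Nr]] := vacH.
rewrite /beta mc_mul big1 // => c _; rewrite fus_N0 ?(mc0 irrH) //.
by rewrite Nr // (negPf ne).
Qed.

Lemma beta_r a (X : 'M_(m a)) : mc X ** beta (r a) = mc X.
Proof.
rewrite -[RHS](mulH1 whaH) -sum_beta (lin_sum linr) (bigD1 (r a)) //= big1 ?addr0 // => e ne.
exact: beta_mulr.
Qed.

Lemma bv_l a : bv (l a) != 0.
Proof. by case: vacH => _ _ /(_ a) []. Qed.

Lemma bv_r a : bv (r a) != 0.
Proof. by case: vacH => _ _ _ /(_ a) []. Qed.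

(** The multiplicity of e in (l e) e is 1 because l e is the left unit of e; reading e instead as a
    right factor of l e forces l e = e and r (l e) = e. *)
Lemma lr_vacuum e : bv e != 0 -> l e = e /\ r e = e.
Proof.
move=> be; have [_ _ Nl Nr] := vacH.
have := (Nl e).2 (l e) (bv_l e) e; rewrite !eqxx /= (Nr (l e)).2 //.
case: andP => // -[/eqP er /eqP le] _; split=> //.
by rewrite [RHS]er le.
Qed.

Lemma l_vacuum e : bv e != 0 -> l e = e. Proof. by case/lr_vacuum. Qed.
Lemma r_vacuum e : bv e != 0 -> r e = e. Proof. by case/lr_vacuum. Qed.

(** Inserting [beta (l a)] on the left of a product changes nothing, yet kills every component with
    another left vacuum. *)
Lemma fusion_l a b c : N a b c != 0%N -> l c = l a.
Proof.
move=> N0; apply/eqP; apply: contraNT N0 => ne; apply/eqP/fus_eq0 => X Y.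
have E : mc X ** mc Y = \sum_c mc (if l c == l a then fus c (X *t Y) else 0).
  rewrite -{1}[mc X]beta_l mulHA mc_mul (lin_sum linr); apply: eq_bigr => d _.
  case: eqP => [<-|/eqP ned]; first by rewrite beta_l.
  by rewrite beta_mull ?(mc0 irrH) // eq_sym.
have := mc_inj irrH (X := fun c => fus c (X *t Y)) (Y := fun c => if l c == l a then fus c (X *t Y) else 0).
by rewrite -mc_mul => /(_ E c) ->; rewrite (negPf ne).
Qed.

Lemma fusion_r a b c : N a b c != 0%N -> r c = r b.
Proof.
move=> N0; apply/eqP; apply: contraNT N0 => ne; apply/eqP/fus_eq0 => X Y.
have E : mc X ** mc Y = \sum_c mc (if r c == r b then fus c (X *t Y) else 0).
  rewrite -{1}[mc Y]beta_r -mulHA mc_mul (lin_sum linl); apply: eq_bigr => d _.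
  case: eqP => [<-|/eqP ned]; first by rewrite beta_r.
  by rewrite beta_mulr ?(mc0 irrH) // eq_sym.
have := mc_inj irrH (X := fun c => fus c (X *t Y)) (Y := fun c => if r c == r b then fus c (X *t Y) else 0).
by rewrite -mc_mul => /(_ E c) ->; rewrite (negPf ne).
Qed.

Lemma fusion_mid a b c : N a b c != 0%N -> r a = l b.
Proof.
move=> N0; apply/eqP; apply: contraNT N0 => ne; apply/eqP/fus_eq0 => X Y.
apply: (mc_eq0 irrH (X := fun c => fus c (X *t Y))).
by rewrite -mc_mul -[mc X]beta_r mulHA beta_mull // (lin0 linr).
Qed.

Lemma antipode_mc a (X : 'M_(m a)) : S (mc X) = mc (Zi a *m X^T *m Z a).
Proof.
apply: ev_injr => f; rewrite -ev_dS !(ev_mc irrH); have [_ _ conj] := conjH a.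
by rewrite -mxtrace_tr trmx_mul conj [RHS]mxtrace_mulC -!mulmxA [LHS]mxtrace_mulC -!mulmxA.
Qed.

(** Read off from the conjugation isomorphisms: up to Z_a, the map f |-> psi_a(Sf) is the transpose
    of a representation, and the psi_a separate points. *)
Lemma dS_mul f g : dS H (dmulH H f g) = dmulH H (dS H g) (dS H f).
Proof.
apply: (psi_eq whaH ssH irrH) => a X; rewrite !(ev_mc irrH); congr (\tr (_ *m _)).
apply: trmx_inj; rewrite (psiM irrH) trmx_mul; have [_ ZiZ conj] := conjH a.
by rewrite !conj (psiM irrH) -!mulmxA (mulmxA (Zi a)) ZiZ mul1mx.
Qed.

Lemma epss_mc a (X : 'M_(m a)) :
  epss H (mc X) = \sum_c mc (fus c
    (\sum_i \sum_j (Zi a *m X^T *m delta_mx i j *m Z a) *t delta_mx i j)).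
Proof.
rewrite -(epss_antipode whaH) (sw_mc irrH); [|move=> ?; linear_slot..].
transitivity (\sum_c \sum_i \sum_j mc (fus c
    ((Zi a *m X^T *m delta_mx i j *m Z a) *t delta_mx i j))); last first.
  apply: eq_bigr => c _; have lc := lin_comp (lin_mc irrH (a := c)) (@lin_fus (bar a) a c).
  rewrite (lin_sum lc); apply: eq_bigr => i _.
  by rewrite (lin_sum lc).
rewrite [RHS]exchange_big; apply: eq_bigr => i _ /=.
rewrite [RHS]exchange_big; apply: eq_bigr => j _ /=.
by rewrite antipode_mc mc_mul trmx_mul trmx_delta mulmxA.
Qed.

(* The image of [epss] is spanned by left legs of the coproduct of 1, which only
   involve the vacuum irreducibles. *)
Lemma epss_vacuum x : exists Q : forall a, 'M[C]_(m a),
  epss H x = \sum_e mc (Q e *m bv e).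
Proof.
exists (fun e => \sum_i \sum_j eps (x ** mc (delta_mx i j)) *: delta_mx j i).
rewrite /epss -sum_beta.
have ls := @lin_sw _ _ H _ (fun a b : V => eps (x ** b) *: a).
rewrite (lin_sum ls); apply: eq_bigr => e _.
have lm : lin (fun A : 'M_(m e) => mc (A *m bv e)).
  by move=> c A B; rewrite mulmxDl -scalemxAl (lin_mc irrH).
rewrite (sw_mc irrH); [|move=> ?; linear_slot..].
rewrite (lin_sum lm); apply: eq_bigr => i _.
rewrite (lin_sum lm); apply: eq_bigr => j _.
by rewrite (linZ lm).
Qed.

(** The counit of epss(chi_c) is dim W_c, which is nonzero. Since epss(A_c) lies in A_{bar c} A_c
    and has only vacuum components, some vacuum occurs in (bar c) c, and its right label identifies
    it as r_c. *)
Lemma N_bar_neq0 c : N (bar c) c (r c) != 0%N.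
Proof.
apply/eqP => N0; have E := epss_mc (1%:M : 'M_(m c)).
have [Q EQ] := epss_vacuum (mc (1%:M : 'M_(m c))); rewrite EQ in E.
have Q0 : \sum_e mc (Q e *m bv e) = 0.
  rewrite big1 // => d _; rewrite (mc_inj irrH E d).
  have [b0|b0] := eqVneq (bv d) 0.
    by rewrite -(mc_inj irrH E d) b0 mulmx0 (mc0 irrH).
  rewrite fus_N0 ?(mc0 irrH) //; apply/eqP/negPn/negP => Nd.
  have := Nd; rewrite -(r_vacuum b0) (fusion_r Nd); exact/negP/negPn/eqP.
have := eps_epss whaH (mc (1%:M : 'M_(m c))).
rewrite EQ Q0 (eps_mc irrH) mxtrace1 => /esym/eqP.
rewrite /epsH (lin0 (@lin_ev _ _ (weps H))) pnatr_eq0 => /eqP m0.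
by have := psi_gt0 irrH c; rewrite m0.
Qed.

Lemma l_bar c : l (bar c) = r c.
Proof. by rewrite -(fusion_l (N_bar_neq0 c)) l_vacuum // bv_r. Qed.

Lemma r_bar c : r (bar c) = l c.
Proof. by rewrite -l_bar hbar. Qed.

(** * Invariant functionals on A *)

Section Functional.
Variables (y_ : I -> C) (h : V).
Hypothesis psi_h : forall a, psi a h = y_ a *: bv a.

(** On the right y_(2) S(y_(3)) is epst(y_(2)), which [sw_epst] turns into a Delta(1) multiplying y
    on the left; the coproduct of x absorbs it. *)
Lemma invariance x y :
  sw x (fun x1 x2 => ev h (x1 ** y) *: x2)
  = sw y (fun y1 y2 => sw (x ** y1) (fun z1 z2 => ev h z1 *: z2) ** S y2).
Proof.
transitivity (sw y (fun y1 y2 => sw x (fun x1 x2 => sw y1 (fun p q =>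
   ev h (x1 ** p) *: (x2 ** q ** S y2))))); last first.
  apply: eq_sw => i j; rewrite (sw_mul whaH); [|move=> ?; linear_slot..].
  rewrite (lin_app_sw linl); apply: eq_sw => x1 x2.
  by rewrite (lin_app_sw linl); apply: eq_sw => p q; rewrite (linZ linl).
rewrite sw_exchange; transitivity (sw x (fun x1 x2 => sw one (fun c d =>
    ev h (x1 ** c ** y) *: (x2 ** d)))).
  by rewrite -(sw_mulr1 whaH x) //; move=> ?; linear_slot.
apply: eq_sw => x1 x2; rewrite (sw_coassoc whaH).
pose F a b := ev h (e_ x1 ** a) *: (e_ x2 ** b).
transitivity (sw y (fun a b => F a (epst H b))).
  rewrite (sw_epst whaH); [|move=> ?; rewrite /F; linear_slot..].
  by apply: eq_sw => c d; rewrite /F mulHA.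
apply: eq_sw => p t; rewrite -(epst_antipode whaH) /F.
have lF : lin (fun z => ev h (e_ x1 ** e_ p) *: (e_ x2 ** z)) by linear_slot.
by rewrite (lin_app_sw lF); apply: eq_sw => q s; rewrite mulHA.
Qed.

Lemma project_mc a (X : 'M_(m a)) :
  sw (mc X) (fun z1 z2 => ev h z1 *: z2) = y_ a *: mc (X *m bv a).
Proof.
apply: ev_injr => f; rewrite (lin_app_sw (@lin_ev _ _ f)).
transitivity (ev (dmulH H h f) (mc X)).
  by rewrite ev_dmulH; apply: (@eq_sw _ _ _ C^o) => i j; rewrite (linZ (@lin_ev _ _ f)).
rewrite (ev_mc irrH) (psiM irrH) psi_h (linZ (@lin_ev _ _ f)) (ev_mc irrH).
by rewrite -scalemxAl -scalemxAr (linZ (@lin_mxtrace _ _)) mulmxA.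
Qed.

(** The element z = h(x_(1) y) x_(2) lies in A_a. By invariance it is also a sum of vacuum
    components times S(y_(2)), hence lies in A_{bar b}. For a != bar b it is therefore zero, and its
    counit is h(xy). *)
Lemma vacuum_orthogonal a b (X : 'M_(m a)) (Y : 'M_(m b)) :
  a != bar b -> ev h (mc X ** mc Y) = 0.
Proof.
move=> ne; set x := mc X; set y := mc Y.
pose z := sw x (fun x1 x2 => ev h (x1 ** y) *: x2).
have [X' zX] : inA a z.
  rewrite /z (sw_mc irrH); [|move=> ?; linear_slot..].
  by do 2!apply: (inA_sum irrH) => ?; apply: (inA_scale irrH); exact: inA_mc.
have [Y' zY] : inA (bar b) z.
  rewrite /z invariance (sw_mc irrH); [|move=> ?; linear_slot..].
  do 2!apply: (inA_sum irrH) => ?; rewrite antipode_mc mc_mul.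
  set P := mc (_ *m _); rewrite (lin_sum (@lin_sw _ _ H _ (fun z1 z2 : V => ev h z1 *: z2))).
  rewrite (lin_sum (@lin_mulHl _ _ H P)); apply: (inA_sum irrH) => d.
  rewrite project_mc (linZ (@lin_mulHl _ _ H P)); apply: (inA_scale irrH).
  have [->|bd] := eqVneq (bv d) 0.
    by rewrite mulmx0 (mc0 irrH) (lin0 linl); exists 0; rewrite (mc0 irrH).
  rewrite /P mc_mul (bigD1 (bar b)) //= big1 ?addr0; first exact: inA_mc.
  move=> c nec; rewrite fus_N0 ?(mc0 irrH) //.
  have [_ _ /(_ (bar b)) [_ Nl] _] := vacH.
  by rewrite Nl // [bar b == c]eq_sym (negPf nec) andbF.
have z0 : z = 0 by rewrite zX (mc_disjoint irrH ne (etrans (esym zX) zY)) (mc0 irrH).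
have <- : eps z = ev h (x ** y).
  rewrite /z /epsH (lin_app_sw (@lin_ev _ _ (weps H))).
  rewrite -(sw_counitr whaH x (F := fun x => ev h (x ** y) : C^o)); last by linear_slot.
  by apply: (@eq_sw _ _ _ C^o) => i j; rewrite (linZ (@lin_ev _ _ (weps H))) [LHS]mulrC.
by rewrite z0 /epsH (lin0 (@lin_ev _ _ (weps H))).
Qed.

End Functional.

(** For the h acting by b_e everywhere, orthogonality kills all elementary tensors, whereas a
    channel mu would let h take the value Tr (X b_e) for every X. *)
Lemma N_vacuum_eq0 a b e : bv e != 0 -> a != bar b -> N a b e = 0%N.
Proof.
move=> be ne; apply/eqP; case E: (N a b e) => [//|N'].
have mu : 'I_(N a b e) by rewrite E; exact: ord0.
have [h hP] := psi_surjective irrH bv.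
pose F (M : 'M_(m a * m b)) : C^o := \sum_c \tr (fus c M *m bv c).
have F_lin : lin F.
  move=> k A B; rewrite /F scaler_sumr -big_split; apply: eq_bigr => c _ /=.
  by rewrite lin_fus mulmxDl -scalemxAl lin_mxtrace.
have F0 X Y : F (X *t Y) = 0.
  rewrite -(@vacuum_orthogonal (fun _ => 1) h _ a b X Y) // => [|c]; last by rewrite scale1r hP.
  rewrite mc_mul (lin_sum (@lin_ev _ _ h)); apply: eq_bigr => c _ /=.
  by rewrite (ev_mc irrH) hP.
case/eqP: be; apply: mxtrace_inj => X; rewrite mulmx0 mxtrace0.
rewrite -(lin_tens0 F_lin F0 (Vt mu *m X *m Wt mu)) /F (bigD1 e) //= fus_VW.
by rewrite big1 ?addr0 // => c nec; rewrite fus_VW0 // mul0mx mxtrace0.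
Qed.

(** * Duality data, the scalars [w] and the pivotal element *)

Section Dimensions.
Variables (theta : forall c, 'cV[C]_(m (bar c) * m c)) (w d : I -> C)
  (g k kinv : V) (xi : I -> C).
Hypotheses (thetaH : forall c, theta_prop hbar Zi (theta c))
  (wH : forall c, w c != 0 /\ forall mu : 'I_(N (bar c) c (r c)),
     theta c *m zeta Z c = w c *: ((Vt mu *m v (r c)) *m (u (r c) *m Wt mu)))
  (dH : forall a, d a ^+ 2 = w a * w (bar a) /\ d a = d (bar a))
  (gH : forall a, psi a g = (d a / w (bar a)) *:
       castmx (erefl (m a), congr1 m (hbar a)) ((Zi a)^T *m Z (bar a)))
  (kH : dual_pivotal H k kinv) (xiH : forall a, psi a k = xi a *: psi a g).

Let w0 c : w c != 0. Proof. by case: (wH c). Qed.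

Let d0 a : d a != 0.
Proof. by rewrite -sqrf_eq0 (dH a).1 mulf_neq0. Qed.

Definition Zb a : 'M[C]_(m (bar a), m a) := castmx (erefl, congr1 m (hbar a)) (Z (bar a)).
Definition Zbi a : 'M[C]_(m a, m (bar a)) := castmx (congr1 m (hbar a), erefl) (Zi (bar a)).

Lemma Zb_Zbi a : Zb a *m Zbi a = 1%:M.
Proof. by have [<- _ _] := conjH (bar a); rewrite /Zb /Zbi; case: _ / (congr1 m (hbar a)). Qed.

Lemma Z_Zi a : Z a *m Zi a = 1%:M. Proof. by case: (conjH a). Qed.
Lemma Zi_Z a : Zi a *m Z a = 1%:M. Proof. by case: (conjH a). Qed.

Lemma theta_E c i j : theta c (mxtens_index (i, j)) 0 = Zbi c j i.
Proof.
have /colP /(_ j) := @thetaH c (delta_mx 0 i); rewrite mxE (bigD1 i) //= big1 ?addr0.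
  rewrite mxE !eqxx mul1r => ->.
  by rewrite castmx_mul castmx_id -/(Zbi c) trmx_delta -colE mxE.
by move=> i' /negPf ne; rewrite mxE ne andbF mul0r.
Qed.

Lemma psi_g a : psi a g = (d a / w (bar a)) *: ((Zi a)^T *m Zb a).
Proof.
rewrite gH; congr (_ *: _).
by rewrite castmx_mul castmx_id.
Qed.

Lemma psi_k_kinv a : psi a k *m psi a kinv = 1%:M.
Proof. by case: kH => [[kk _ _ _] _]; rewrite -(psiM irrH) kk (psi1 irrH). Qed.

Lemma xi0 a : xi a != 0.
Proof.
apply: contra_neq (one_neq0_mx a) => x0.
by rewrite -(psi_k_kinv a) xiH x0 scale0r mul0mx.
Qed.

Lemma psi_kinv a : psi a kinv = (w (bar a) / (xi a * d a)) *: (Zbi a *m (Z a)^T).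
Proof.
have E : (Zi a)^T *m Zb a *m (Zbi a *m (Z a)^T) = 1%:M.
  by rewrite mulmxA -(mulmxA _ (Zb a)) Zb_Zbi mulmx1 -trmx_mul Z_Zi trmx1.
have Ek : psi a k *m ((w (bar a) / (xi a * d a)) *: (Zbi a *m (Z a)^T)) = 1%:M.
  rewrite xiH psi_g -scalemxAr -!scalemxAl E !scalerA -[RHS]scale1r; congr (_ *: _).
  by field; rewrite w0 xi0 d0.
have /mulmx1C := psi_k_kinv a => kk.
by rewrite -[RHS]mul1mx -kk -mulmxA Ek mulmx1.
Qed.

Lemma theta_zeta c (mu : 'I_(N (bar c) c (r c))) :
  theta c *m zeta Z c = Vt mu *m (w c *: bv (r c)) *m Wt mu.
Proof.
have [_ /(_ mu) ->] := wH c; have [_ /(_ _ (bv_r c)) -> _ _] := vacH.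
by rewrite -!scalemxAr -scalemxAl !mulmxA.
Qed.

Lemma N_bar_gt0 c : (0 < N (bar c) c (r c))%N.
Proof. by rewrite lt0n N_bar_neq0. Qed.

Definition ord_N_bar c := Ordinal (N_bar_gt0 c).

(** The identity defining w_c holds for every mu. Two distinct channels would give the same matrix,
    but compressing it by one channel gives w_c b_{r_c} and the other contributes zero. *)
Lemma N_bar1 c : N (bar c) c (r c) = 1%N.
Proof.
have := N_bar_neq0 c; case E: (N _ _ _) => [//|[//|N']] _.
have [lt0 lt1] : (0 < N (bar c) c (r c))%N /\ (1 < N (bar c) c (r c))%N by rewrite E.
pose mu := Ordinal lt0; pose nu := Ordinal lt1; have [_ WV _] := fusH.
case/eqP: (bv_r c); apply: (scalerI (w0 c)); rewrite scaler0.
transitivity (Wt mu *m (Vt mu *m (w c *: bv (r c)) *m Wt mu) *m Vt mu).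
  by rewrite !mulmxA WV eqxx mul1mx -mulmxA WV eqxx mulmx1.
rewrite -theta_zeta (theta_zeta nu) !mulmxA WV (_ : (mu == nu) = false) //.
by rewrite mul_scalar_mx scale0r !mul0mx.
Qed.

Lemma N_bar_vacuum c e : bv e != 0 -> N (bar c) c e = (e == r c).
Proof.
move=> be; case: eqP => [->|/eqP ne]; first exact: N_bar1.
apply/eqP/negPn/negP => N0; case/eqP: ne.
by rewrite -(fusion_r N0) r_vacuum.
Qed.

Lemma sum_N_vacuum a b : (\sum_(e | bv e != 0%R) N a b e = (a == bar b))%N.
Proof.
case: eqP => [->|/eqP ne]; last by rewrite big1 // => e be; rewrite N_vacuum_eq0.
rewrite (bigD1 (r b)) ?bv_r //= N_bar_vacuum ?bv_r // eqxx big1 // => e /andP [be ne].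
by rewrite N_bar_vacuum // (negPf ne).
Qed.

Lemma fus_theta_zeta c e : fus e (theta c *m zeta Z c) =
  (if e == r c then w c else 0) *: bv e.
Proof.
rewrite (theta_zeta (ord_N_bar c)); case: eqP => [->|/eqP ne]; first by rewrite fus_VW.
by rewrite fus_VW0 // scale0r.
Qed.

(** For this coefficient matrix the tensor in [epss_mc] is exactly theta zeta: its factor Zi Z
    cancels, leaving the entries of Zbi and Z. *)
Lemma epss_theta_zeta a : epss H (mc (Zbi a *m (Z a)^T)) = w a *: beta (r a).
Proof.
rewrite epss_mc; set M := \sum_i _.
have -> : M = theta a *m zeta Z a.
  apply/matrixP => x y; case: (mxtens_indexP x) => p q; case: (mxtens_indexP y) => p' q'.
  rewrite [RHS]mxE big_ord1 [X in _ * X]mxE mxtens_indexK theta_E /=.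
  rewrite trmx_mul trmxK mulmxA Zi_Z mul1mx in M *.
  rewrite /M summxE (bigD1 q) //= summxE (bigD1 q') //= !big1 ?addr0 => [|i ne|j ne].
  - by rewrite tensmxE mul_delta_entry !mxE !eqxx mulr1.
  - by rewrite summxE big1 // => j _; rewrite tensmxE [X in _ * X]mxE [q == i]eq_sym (negPf ne) mulr0.
  - by rewrite tensmxE [X in _ * X]mxE [q' == j]eq_sym (negPf ne) andbF mulr0.
under eq_bigr do rewrite fus_theta_zeta (linZ (lin_mc irrH (a := _))).
rewrite (bigD1 (r a)) //= eqxx big1 ?addr0 // => e /negPf ->.
by rewrite scale0r.
Qed.

(** The dimension of a for the pivotal structure k. A change of sign of d_a is compensated by xi_a,
    so this quotient depends on k but not on the chosen square root. *)
Definition qdim a := d a / xi a.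

Lemma qdim0 a : qdim a != 0.
Proof. by rewrite mulf_neq0 ?invr_eq0 ?d0 ?xi0. Qed.

(** psi_a(k^-1) is w_{bar a} / (xi_a d_a) times the matrix of [epss_theta_zeta], and w_a w_{bar a} =
    d_a^2 simplifies the resulting scalar. *)
Lemma epss_chi a : epss H (mc (psi a kinv)) = qdim a *: beta (r a).
Proof.
rewrite psi_kinv (linZ (lin_mc irrH (a := a))) (linZ (@lin_epss _ _ H)) epss_theta_zeta scalerA.
congr (_ *: _); rewrite /qdim; apply: (mulfI (d0 a)).
transitivity (w a * w (bar a) / xi a); first by field; rewrite xi0 d0.
by rewrite -(dH a).1 expr2 mulrA.
Qed.

Let k_gl : dual_grouplike H k kinv. Proof. by case: kH. Qed.
Let dSk : dS H k = kinv. Proof. exact: (dS_grouplike whaH k_gl dS_mul). Qed.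

Lemma castmx_Z a b (e : b = a) p (e' : m (bar b) = m (bar a)) (M : 'M[C]_(p, m b)) :
  castmx (erefl p, e') (M *m Z b) = castmx (erefl p, congr1 m e) M *m Z a.
Proof. by subst b; rewrite !castmx_id. Qed.

Lemma psi_bar_g a : psi (bar a) g = (d a / w a) *: ((Zbi a)^T *m Z a).
Proof.
rewrite gH -(dH a).2; congr (d a / _ *: _); first by rewrite hbar.
by rewrite (castmx_Z (hbar a)) /Zbi trmx_cast.
Qed.

(** S(k) = k^-1 evaluated in psi_a and, through Z_a, in psi_{bar a} gives two multiples of the same
    invertible matrix. *)
Lemma xi_bar a : xi a * xi (bar a) = 1.
Proof.
have [_ _ /(_ k)] := conjH a; rewrite dSk psi_kinv xiH psi_bar_g scalerA.
rewrite -scalemxAr -!scalemxAl !linearZ /= trmx_mul trmxK.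
rewrite -!mulmxA Z_Zi mulmx1 => E.
have P0 : Z a *m (Zbi a)^T != 0.
  apply: contra_neq (one_neq0_mx a) => P0.
  transitivity (Z a *m (Zbi a)^T *m ((Zb a)^T *m Zi a)); last by rewrite P0 mul0mx.
  by rewrite mulmxA -(mulmxA _ (Zbi a)^T) -trmx_mul Zb_Zbi trmx1 mulmx1 Z_Zi.
have {E} E : w (bar a) / (xi a * d a) = xi (bar a) * (d a / w a).
  by apply/eqP; rewrite -subr_eq0; move/eqP: E; rewrite -subr_eq0 -scalerBl scaler_eq0 (negPf P0) orbF.
have dd := (dH a).1.
transitivity (xi a * xi (bar a) * (d a ^+ 2 / (w a * w (bar a)))).
  by rewrite dd divff ?mulf_neq0 // mulr1.
transitivity (xi a * d a / w (bar a) * (xi (bar a) * (d a / w a))).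
  by field; rewrite !w0.
by rewrite -E; field; rewrite w0 xi0 d0.
Qed.

Lemma qdim_mul_bar a : qdim a * qdim (bar a) = d a ^+ 2.
Proof.
rewrite /qdim -(dH a).2 mulf_div xi_bar divr1 expr2 //.
Qed.

Lemma hit_mc f a (X : 'M_(m a)) : hit H f (mc X) = mc (psi a f *m X).
Proof.
apply: ev_injr => f'; rewrite ev_hit !(ev_mc irrH) (psiM irrH).
by rewrite mulmxA mxtrace_mulC mulmxA.
Qed.

Lemma hitK x : hit H k (hit H kinv x) = x.
Proof.
case: k_gl => kk _ _ _.
by apply: ev_injr => f; rewrite !ev_hit (dmulHA whaH) kk (dmulH1 whaH).
Qed.

Lemma hitKV x : hit H kinv (hit H k x) = x.
Proof.
case: k_gl => _ kk _ _.
by apply: ev_injr => f; rewrite !ev_hit (dmulHA whaH) kk (dmulH1 whaH).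
Qed.

Lemma hit_kinv_mul x y : hit H kinv (x ** y) = hit H kinv x ** hit H kinv y.
Proof.
by rewrite -{1}[x]hitK -{1}[y]hitK -(hit_mul whaH k_gl) hitKV.
Qed.

(** * Characters and the symmetries of the fusion multiplicities *)

Definition chi a := mc (1%:M : 'M_(m a)).

Lemma chi_mul a b : chi a ** chi b = \sum_c mc ((N a b c)%:R%:M : 'M_(m c)).
Proof.
have [_ WV _] := fusH; rewrite mc_mul; apply: eq_bigr => c _; congr (_ _).
have -> : 1%:M *t 1%:M = 1%:M :> 'M[C]_(m a * m b).
  apply/matrixP => x y; case: (mxtens_indexP x) => p q; case: (mxtens_indexP y) => p' q'.
  by rewrite tensmxE !mxE (inj_eq (can_inj (@mxtens_indexK _ _))) xpair_eqE -natrM mulnb.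
rewrite /fus (eq_bigr (fun _ => 1%:M)) => [|mu _]; last by rewrite mulmx1 WV eqxx.
by rewrite sumr_const card_ord raddfMn.
Qed.

Lemma mc_scalar a (c : C) : mc (c%:M : 'M_(m a)) = c *: chi a.
Proof. by rewrite -scalemx1 (linZ (lin_mc irrH (a := a))). Qed.

Lemma chi_coef_inj (F G : I -> C) :
  \sum_c F c *: chi c = \sum_c G c *: chi c -> F =1 G.
Proof.
move=> FG c; have := mc_inj irrH (X := fun c => (F c)%:M) (Y := fun c => (G c)%:M).
under eq_bigr do rewrite mc_scalar; under [X in _ = X -> _]eq_bigr do rewrite mc_scalar.
move=> /(_ FG c) E; apply/eqP; rewrite -subr_eq0.
have : (F c - G c)%:M = 0 :> 'M[C]_(m c) by rewrite raddfB /= E subrr.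
by rewrite -scalemx1 => /eqP; rewrite scaler_eq0 (negPf (one_neq0_mx c)) orbF.
Qed.

Lemma chi_mulE a b : chi a ** chi b = \sum_c (N a b c)%:R *: chi c.
Proof. by rewrite chi_mul; apply: eq_bigr => c _; rewrite mc_scalar. Qed.

Lemma antipode_chi a : S (chi a) = chi (bar a).
Proof. by rewrite antipode_mc trmx1 mulmx1 Zi_Z. Qed.

Lemma bar_inj : injective bar.
Proof. exact: can_inj hbar. Qed.

Lemma N_anti a b c : N (bar b) (bar a) (bar c) = N a b c.
Proof.
have E : \sum_c (N a b (bar c))%:R *: chi c = \sum_c (N (bar b) (bar a) c)%:R *: chi c.
  rewrite -chi_mulE -!antipode_chi -(antipode_mul whaH) chi_mulE (lin_sum (@lin_SH _ _ H)).
  rewrite (reindex_inj bar_inj); apply: eq_bigr => e _ /=.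
  by rewrite hbar (linZ (@lin_SH _ _ H)) antipode_chi.
by have /eqP := chi_coef_inj E (bar c); rewrite hbar eqr_nat => /eqP ->.
Qed.

Lemma N_assoc a b c e :
  (\sum_x N a b x * N x c e = \sum_y N b c y * N a y e)%N.
Proof.
have E : \sum_e (\sum_x N a b x * N x c e)%N%:R *: chi e
       = \sum_e (\sum_y N b c y * N a y e)%N%:R *: chi e.
  transitivity (chi a ** chi b ** chi c).
    rewrite chi_mulE (lin_sum linl) /=.
    under eq_bigr do rewrite natr_sum scaler_suml.
    rewrite exchange_big; apply: eq_bigr => x _ /=; rewrite (linZ linl) chi_mulE scaler_sumr.
    by apply: eq_bigr => y _; rewrite natrM scalerA.
  rewrite mulHA chi_mulE [LHS](lin_sum linr) /=.
  under [RHS]eq_bigr do rewrite natr_sum scaler_suml.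
  rewrite [RHS]exchange_big; apply: eq_bigr => x _ /=; rewrite (linZ linr) chi_mulE scaler_sumr.
  by apply: eq_bigr => y _; rewrite natrM scalerA.
by have /eqP := chi_coef_inj E e; rewrite eqr_nat => /eqP.
Qed.

(** Both sides count the vacuum in the triple product of a, b and bar c, bracketed in the two
    ways. *)
Lemma N_cyclic a b c : N a b c = N b (bar c) (bar a).
Proof.
transitivity (\sum_(e | bv e != 0%R) \sum_x N a b x * N x (bar c) e)%N.
  rewrite exchange_big (bigD1 c) //= [X in (_ + X)%N]big1 ?addn0 => [|x ne].
    by rewrite -(@big_distrr _ _ muln) /= sum_N_vacuum hbar eqxx muln1.
  by rewrite -(@big_distrr _ _ muln) /= sum_N_vacuum hbar (negPf ne) muln0.
rewrite (eq_bigr _ (fun e _ => N_assoc a b (bar c) e)).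
rewrite exchange_big (bigD1 (bar a)) //= [X in (_ + X)%N]big1 ?addn0 => [|x ne].
  by rewrite -(@big_distrr _ _ muln) /= sum_N_vacuum hbar eqxx muln1.
rewrite -(@big_distrr _ _ muln) /= sum_N_vacuum; case: eqP => [ax|]; last by rewrite muln0.
by rewrite ax hbar eqxx in ne.
Qed.

Lemma N_frobenius a b c : N a b c = N (bar a) c b.
Proof. by rewrite -N_anti N_cyclic !hbar. Qed.

(** Twisting by k^-1 is multiplicative, so twisted characters multiply with the same N. Applying
    epss(xy) = epss(epss(x) y) to such a product replaces each factor by its scalar, times the
    vacuum element. *)
Lemma qdim_mul a b :
  \sum_c (N a b c)%:R * qdim c = if r a == l b then qdim a * qdim b else 0.
Proof.
have chiE c : hit H kinv (chi c) = mc (psi c kinv) by rewrite hit_mc mulmx1.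
have b0 : beta (r b) != 0.
  apply: contra_neq (bv_r b) => b0; apply: (mc_inj1 irrH).
  by rewrite (mc0 irrH).
have E : epss H (mc (psi a kinv) ** mc (psi b kinv))
   = (\sum_c (N a b c)%:R * qdim c) *: beta (r b).
  rewrite -!chiE -hit_kinv_mul chi_mulE (lin_sum (@lin_hit _ _ H kinv)).
  rewrite (lin_sum (@lin_epss _ _ H)) scaler_suml; apply: eq_bigr => c _.
  rewrite (linZ (@lin_hit _ _ H kinv)) (linZ (@lin_epss _ _ H)) chiE epss_chi scalerA.
  have [N0|N0] := eqVneq (N a b c) 0%N; first by rewrite N0 mul0r !scale0r.
  by rewrite (fusion_r N0).
rewrite (epss_mul whaH) epss_chi (linZ linl) (linZ (@lin_epss _ _ H)) in E.
have scaleI p q : p *: beta (r b) = q *: beta (r b) -> p = q.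
  move/eqP; rewrite -subr_eq0 -scalerBl scaler_eq0 (negPf b0) orbF subr_eq0.
  by move/eqP.
apply: scaleI; rewrite -E; case: eqP => [->|/eqP ne].
  by rewrite beta_l epss_chi scalerA.
by rewrite beta_mull // (lin0 (@lin_epss _ _ H)) scaler0 scale0r.
Qed.

Section Orthogonality.
Variables (y_ : I -> C) (h : V).
Hypothesis psi_h : forall a, psi a h = y_ a *: bv a.

(** The only vacuum in (bar a) a is r_a, with a single channel, and on that channel theta zeta
    computes the value of h. *)
Lemma orthogonality a (X Y : 'M_(m a)) :
  ev h (S (mc X) ** mc Y) = y_ (r a) / qdim a * \tr (Y *m psi a kinv *m X).
Proof.
rewrite antipode_mc mc_mul (lin_sum (@lin_ev _ _ h)) /=.
set X' := Zi a *m X^T *m Z a.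
rewrite (bigD1 (r a)) //= big1 ?addr0 => [|c ne]; last first.
  have [b0|b0] := eqVneq (bv c) 0.
    by rewrite (ev_mc irrH) psi_h b0 scaler0 mulmx0 mxtrace0.
  rewrite fus_N0; first by rewrite (mc0 irrH) (lin0 (@lin_ev _ _ h)).
  by rewrite N_bar_vacuum // (negPf ne).
have E : w a * \tr (fus (r a) (X' *t Y) *m bv (r a)) = \tr ((X' *t Y) *m (theta a *m zeta Z a)).
  rewrite /fus mulmx_suml (lin_sum (@lin_mxtrace _ _)) /=.
  rewrite (bigD1 (ord_N_bar a)) //= big1 ?addr0 => [|mu ne]; last first.
    case/eqP: ne; apply: val_inj => /=.
    have : (mu < 1)%N by rewrite -(N_bar1 a) ltn_ord.
    by rewrite ltnS leqn0 => /eqP.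
  rewrite (theta_zeta (ord_N_bar a)) -!scalemxAr -!scalemxAl -scalemxAr.
  rewrite (linZ (@lin_mxtrace _ _)); congr (_ * _).
  by rewrite -!mulmxA mxtrace_mulC !mulmxA.
(* In coordinates the trace contracts theta to Zbi and zeta to Z; the Z from zeta cancels the Zi
   introduced by S. *)
have E' : \tr ((X' *t Y) *m (theta a *m zeta Z a)) = \tr (Y *m (Zbi a *m (Z a)^T) *m X).
  transitivity (\tr (Y *m Zbi a *m X'^T *m (Z a)^T)); last first.
    rewrite /X' !trmx_mul trmxK -!mulmxA -[(Zi a)^T *m _]trmx_mul Z_Zi trmx1 mulmx1 //.
  rewrite mulmxA mxtrace_mulC /mxtrace big_ord1 mxE big_mxtens exchange_big /=.
  apply: eq_bigr => q _; rewrite mxE; apply: eq_bigr => p _.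
  rewrite mxE mxtens_indexK /= mulrC [(Z a)^T _ _]mxE; congr (_ * _).
  rewrite mxE big_mxtens mxE; apply: eq_bigr => p' _.
  rewrite [X'^T _ _]mxE mxE mulr_suml; apply: eq_bigr => q' _.
  by rewrite tensmxE theta_E; ring.
rewrite (ev_mc irrH) psi_h -scalemxAr (linZ (@lin_mxtrace _ _)) psi_kinv.
rewrite -scalemxAr -scalemxAl (linZ (@lin_mxtrace _ _)) -E' -E.
rewrite /qdim /GRing.scale /=.
have := (dH a).1; rewrite expr2 => dd.
transitivity (y_ (r a) * (w a * w (bar a) / (d a * d a)) * \tr (fus (r a) (X' *t Y) *m bv (r a))).
  by rewrite dd divff ?mulf_neq0 // mulr1.
by field; rewrite d0 xi0.
Qed.

End Orthogonality.

Lemma qdim_bar_mul a b :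
  \sum_c (N a b c)%:R * qdim (bar c) = if r a == l b then qdim (bar a) * qdim (bar b) else 0.
Proof.
transitivity (\sum_c (N (bar b) (bar a) c)%:R * qdim c).
  by rewrite [RHS](reindex_inj bar_inj); apply: eq_bigr => c _; rewrite N_anti.
by rewrite qdim_mul r_bar l_bar eq_sym mulrC.
Qed.

(** Frobenius reciprocity moves the summation to the lower index, giving the multiplication rule for
    bar a. *)
Lemma sum_N_qdim a c :
  \sum_b (N a b c)%:R * qdim b = if l c == l a then qdim (bar a) * qdim c else 0.
Proof.
transitivity (\sum_b (N (bar a) c b)%:R * qdim b); last by rewrite qdim_mul r_bar eq_sym.
by apply: eq_bigr => b _; rewrite N_frobenius.
Qed.

(** * Global dimensions and positivity *)

Definition gdim e := \sum_(x | l x == e) d x ^+ 2.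

(** Sum N_{ab}^c qdim(b) qdim(bar c) over both b and c. Summing over b first gives qdim(bar a) times
    the left side, over c first qdim(bar a) times the right side. *)
Lemma gdim_lr a : gdim (l a) = gdim (r a).
Proof.
apply: (mulfI (qdim0 (bar a))).
transitivity (\sum_c \sum_b (N a b c)%:R * qdim b * qdim (bar c)).
  rewrite /gdim mulr_sumr [LHS]big_mkcond; apply: eq_bigr => c _ /=.
  rewrite -mulr_suml sum_N_qdim; case: eqP => _; last by rewrite mul0r.
  by rewrite -qdim_mul_bar; ring.
rewrite exchange_big /gdim mulr_sumr [RHS]big_mkcond; apply: eq_bigr => b _ /=.
transitivity (qdim b * \sum_c (N a b c)%:R * qdim (bar c)).
  by rewrite mulr_sumr; apply: eq_bigr => c _; ring.
rewrite qdim_bar_mul eq_sym; case: eqP => _; last by rewrite mulr0.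
by rewrite -qdim_mul_bar; ring.
Qed.

(* Pairing the eigenvector (qdim b) of left multiplication by a with its complex
   conjugate shows qdim a and the conjugate of qdim (bar a) have the same phase. *)
Lemma d_sqr_gt0 a : 0 < d a ^+ 2.
Proof.
pose P e := \sum_(x | l x == e) qdim x * (qdim x)^*.
have P_gt0 b : 0 < P (l b).
  rewrite /P (bigD1 b) //= ltr_wpDr ?mul_conjC_gt0 ?qdim0 //.
  by apply: sumr_ge0 => x _; rewrite mul_conjC_ge0.
have E : qdim a * P (r a) = (qdim (bar a))^* * P (l a).
  transitivity (\sum_b \sum_c (N a b c)%:R * qdim c * (qdim b)^*).
    rewrite /P mulr_sumr [LHS]big_mkcond; apply: eq_bigr => b _ /=.
    rewrite -mulr_suml qdim_mul eq_sym; case: eqP => _; last by rewrite mul0r.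
    by rewrite mulrA.
  rewrite exchange_big /P mulr_sumr [RHS]big_mkcond; apply: eq_bigr => c _ /=.
  transitivity (qdim c * (\sum_b (N a b c)%:R * qdim b)^*).
    rewrite rmorph_sum mulr_sumr; apply: eq_bigr => b _ /=.
    by rewrite (rmorphM _ _%:R) rmorph_nat; ring.
  rewrite sum_N_qdim; case: eqP => _; last by rewrite rmorph0 mulr0.
  by rewrite (rmorphM _ (qdim (bar a))); ring.
have {}E : d a ^+ 2 * P (r a) = qdim (bar a) * (qdim (bar a))^* * P (l a).
  by rewrite -qdim_mul_bar -mulrA -[RHS]mulrA -E; ring.
have := P_gt0 (bar a); rewrite l_bar => Pr.
by rewrite -(pmulr_lgt0 _ Pr) E mulr_gt0 // mul_conjC_gt0 qdim0.
Qed.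

Lemma gdim0 a : gdim (l a) != 0.
Proof.
rewrite gt_eqF // /gdim (bigD1 a) //= ltr_wpDr ?d_sqr_gt0 //.
by apply: sumr_ge0 => x _; apply/ltW/d_sqr_gt0.
Qed.

(** * Idempotence and non-degeneracy of Omega *)

Variable Omega : V.
Hypothesis OmegaH : forall f, ev f Omega =
  \sum_a (1 / (\sum_(x | l x == l a) d x ^+ 2)) * (d a / xi a) * \tr (psi a f).

Definition Omega_coef a := 1 / gdim (l a) * qdim a.

Lemma Omega_coef0 a : Omega_coef a != 0.
Proof. by apply: mulf_neq0; [rewrite div1r invr_eq0 gdim0 | exact: qdim0]. Qed.

Lemma ev_Omega f : ev f Omega = \sum_a Omega_coef a * \tr (psi a f).
Proof. exact: OmegaH. Qed.

Lemma ev_Omega_mul f f' : ev (dmulH H f f') Omega = \sum_a Omega_coef a * \tr (psi a f *m psi a f').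
Proof. by rewrite ev_Omega; apply: eq_bigr => a _; rewrite (psiM irrH). Qed.

Lemma OmegaE : Omega = \sum_a Omega_coef a *: chi a.
Proof.
apply: ev_injr => f; rewrite ev_Omega (lin_sum (@lin_ev _ _ f)); apply: eq_bigr => a _.
by rewrite (linZ (@lin_ev _ _ f)) (ev_mc irrH) mul1mx.
Qed.

(** Fusion forces l_b = r_a, so the weight of b equals that of a and leaves the sum over b. That sum
    is qdim(bar a) qdim(c); summing the resulting d_a^2 over l_a = l_c cancels one global
    dimension. *)
Lemma Omega_idem : Omega ** Omega = Omega.
Proof.
transitivity (\sum_c (\sum_a \sum_b Omega_coef a * (Omega_coef b * (N a b c)%:R)) *: chi c).
  rewrite {1}OmegaE (lin_sum linl) {1}OmegaE.
  under [RHS]eq_bigr do rewrite scaler_suml.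
  rewrite [RHS]exchange_big; apply: eq_bigr => a _ /=.
  rewrite (linZ linl) (lin_sum linr) scaler_sumr.
  under [RHS]eq_bigr do rewrite scaler_suml.
  rewrite [RHS]exchange_big; apply: eq_bigr => b _ /=.
  rewrite (linZ linr) chi_mulE !scaler_sumr; apply: eq_bigr => c _.
  by rewrite !scalerA mulrA.
rewrite [RHS]OmegaE; apply: eq_bigr => c _; congr (_ *: _).
transitivity (\sum_(a | l a == l c) d a ^+ 2 * (qdim c / gdim (l c) ^+ 2)).
  rewrite [RHS]big_mkcond; apply: eq_bigr => a _ /=; rewrite -mulr_sumr.
  transitivity (Omega_coef a * (1 / gdim (l a) * \sum_b (N a b c)%:R * qdim b)).
    congr (_ * _); rewrite mulr_sumr; apply: eq_bigr => b _.
    have [->|N0] := eqVneq (N a b c) 0%N; first by rewrite mul0r !mulr0.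
    by rewrite /Omega_coef -(fusion_mid N0) -gdim_lr; ring.
  rewrite sum_N_qdim eq_sym; case: eqP => [E|_]; last by rewrite !mulr0.
  by rewrite /Omega_coef E -qdim_mul_bar; field; rewrite gdim0.
by rewrite -mulr_suml -/(gdim (l c)) /Omega_coef; field; rewrite gdim0.
Qed.

Lemma mulmx_Delta f f' : (f *m Delta H Omega *m f'^T) 0 0 = ev (dmulH H f f') Omega.
Proof.
rewrite -ev_Delta mxE exchange_big; apply: eq_bigr => j _ /=.
by rewrite !mxE mulr_suml.
Qed.

(** The coproduct of Omega is the Gram matrix on the dual of a weighted trace form with nonzero
    weights, so a vector in its kernel is killed by every irreducible. *)
Lemma Delta_Omega_unit : Delta H Omega \in unitmx.
Proof.
rewrite -row_free_unit -kermx_eq0; apply/eqP/row_matrixP => i; rewrite row0.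
set f := row i _; have f0 : f *m Delta H Omega = 0 by rewrite -row_mul mulmx_ker row0.
apply: (psi_separating whaH ssH irrH) => a; apply: (scalerI (Omega_coef0 a)); rewrite scaler0.
apply: (mcoef_free irrH (X := fun a => Omega_coef a *: psi a f)) => f'.
transitivity (ev (dmulH H f f') Omega); last by rewrite -mulmx_Delta f0 mul0mx mxE.
by rewrite ev_Omega_mul; apply: eq_bigr => b _; rewrite -scalemxAl (linZ (@lin_mxtrace _ _)).
Qed.

Lemma Delta_Omega_sym : (Delta H Omega)^T = Delta H Omega.
Proof.
apply/matrixP => i j; rewrite mxE.
have D p q : Delta H Omega p q = ev (dmulH H (e_ p) (e_ q)) Omega.
  by rewrite -mulmx_Delta trmx_delta -colE -rowE !mxE.
rewrite !D !ev_Omega_mul; apply: eq_bigr => a _.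
by rewrite mxtrace_mulC.
Qed.

Lemma mc_onto x : exists X : forall a, 'M[C]_(m a), x = \sum_a mc (X a).
Proof.
pose f := x *m invmx (Delta H Omega); exists (fun a => Omega_coef a *: psi a f).
apply: ev_injr => f'; rewrite [RHS](lin_sum (@lin_ev _ _ f')).
transitivity (ev (dmulH H f f') Omega).
  rewrite -mulmx_Delta mulmxKV ?Delta_Omega_unit // mxE; apply: eq_bigr => i _.
  by rewrite mxE mulrC.
rewrite ev_Omega_mul; apply: eq_bigr => a _.
by rewrite (ev_mc irrH) -scalemxAl (linZ (@lin_mxtrace _ _)).
Qed.

(** * The form h(S(x) y) as inverse of the coproduct of Omega *)

Definition hdual h x : V := \row_i ev h (S x ** e_ i).

Lemma ev_hdual h x y : ev (hdual h x) y = ev h (S x ** y).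
Proof.
have lh : lin (fun y => ev h (S x ** y) : C^o) by linear_slot.
by rewrite (lin_bvec y lh); apply: eq_bigr => i _; rewrite mxE [LHS]mulrC.
Qed.

Section Integral.
Variable h : V.
Hypothesis psi_h : forall a, psi a h = gdim a *: bv a.

(** Orthogonality contributes the weight gdim(r_b) / qdim(b). Replacing r_b by l_b makes it the
    inverse of the coefficient of Omega, which is why h is normalized by [gdim]. *)
Lemma psi_hdual (X : forall a, 'M[C]_(m a)) b :
  psi b (hdual h (\sum_a mc (X a))) = (Omega_coef b)^-1 *: (psi b kinv *m X b).
Proof.
apply: mxtrace_inj => Y; rewrite -(ev_mc irrH) ev_hdual.
have lh : lin (fun x => ev h (S x ** mc Y) : C^o) by linear_slot.
rewrite (lin_sum lh) (bigD1 b) //= big1 ?addr0 => [|a ne]; last first.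
  by rewrite antipode_mc (vacuum_orthogonal psi_h) // (inj_eq bar_inj).
rewrite (orthogonality psi_h) -scalemxAr (linZ (@lin_mxtrace _ _)) mulmxA.
by congr (_ * _); rewrite /Omega_coef -gdim_lr; field; rewrite gdim0 qdim0.
Qed.

Lemma hit_hdual x : hit H (hdual h x) Omega = hit H kinv x.
Proof.
have [X ->] := mc_onto x; apply: ev_injr => f; rewrite !ev_hit ev_Omega_mul.
rewrite [RHS](lin_sum (@lin_ev _ _ _)); apply: eq_bigr => a _.
rewrite psi_hdual -scalemxAr (linZ (@lin_mxtrace _ _)) [LHS]mulrA divff ?Omega_coef0 // mul1r.
by rewrite (ev_mc irrH) (psiM irrH) [RHS]mxtrace_mulC mulmxA.
Qed.

Lemma hdual_onto f : exists x, hdual h x = f.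
Proof.
exists (\sum_a mc (Omega_coef a *: (psi a k *m psi a f))).
apply: (psi_eq whaH ssH irrH) => a Y; rewrite !(ev_mc irrH) psi_hdual; congr (\tr (_ *m _)).
rewrite -scalemxAr scalerA mulVf ?Omega_coef0 // scale1r mulmxA.
by rewrite (mulmx1C (psi_k_kinv a)) mul1mx.
Qed.

End Integral.

(** On the dual S^2 is conjugation by k, hence surjective; so S has no kernel on A, which is
    finite-dimensional. *)
Lemma antipode_onto x : exists z, S z = x.
Proof.
have [_ kS] := kH; have [kk k'k _ _] := k_gl.
suff wSu : wS H \in unitmx by exists (x *m invmx (wS H)); rewrite /SH mulmxKV.
rewrite -row_free_unit -kermx_eq0; apply/eqP/row_matrixP => i; rewrite row0.
set z := row i _; have z0 : S z = 0 by rewrite /SH -row_mul mulmx_ker row0.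
apply: ev_injr => f; rewrite [RHS](lin0 (@lin_ev _ _ f)).
transitivity (ev (dmulH H (dmulH H k (dmulH H (dmulH H kinv f) k)) kinv) z).
  by rewrite -!(dmulHA whaH) kk (dmul1H whaH) (dmulHA whaH) kk (dmulH1 whaH).
by rewrite -kS !ev_dS z0 (lin0 (@lin_SH _ _ H)) (lin0 (@lin_ev _ _ _)).
Qed.

(** * The transfer map *)

Definition Tmx : 'M[C]_n := \matrix_i S (hit H k (e_ i)).

Lemma TmxE x : x *m Tmx = S (hit H k x).
Proof.
have lT : lin (fun x => S (hit H k x)).
  by apply: lin_comp; [exact: lin_SH | exact: lin_hit].
by rewrite (lin_bvec x lT) mulmx_sum_row; apply: eq_bigr => i _; rewrite rowK.
Qed.

Lemma ev_Tmx f x : ev f (x *m Tmx) = ev (dmulH H (dS H f) k) x.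
Proof. by rewrite TmxE -ev_dS ev_hit. Qed.

(** Dually f becomes S(S(f) k) = S(k) S^2(f) = k^-1 k f k^-1 = f k^-1. *)
Lemma Tmx_antipode z : S z *m Tmx = hit H kinv z.
Proof.
have [_ kS] := kH; have [kk k'k _ _] := k_gl.
apply: ev_injr => f; rewrite ev_Tmx ev_hit -ev_dS dS_mul dSk kS.
by rewrite -!(dmulHA whaH) k'k (dmul1H whaH).
Qed.

Lemma lin_tensl y : lin (fun x : V => tens x y).
Proof. by move=> c x z; rewrite /tens linearP /= mulmxDl -scalemxAl. Qed.

Lemma lin_tensr x : lin (fun y : V => tens x y).
Proof. by move=> c y z; rewrite /tens mulmxDr -scalemxAr. Qed.

Lemma mul2_tens_Delta p q x :
  mul2 (wmul H) (tens p q) (Delta H x) = sw x (fun a b => tens (p ** a) (q ** b)).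
Proof.
rewrite /mul2 /sweedler.
under eq_bigr do rewrite exchange_big /=.
rewrite exchange_big /=; apply: eq_bigr => s _.
under eq_bigr do rewrite exchange_big /=.
rewrite exchange_big /=; apply: eq_bigr => t _.
have l1 : lin (fun p => tens (p ** e_ s) (q ** e_ t)).
  exact: (lin_comp (lin_tensl _) (@lin_mulHl _ _ H _)).
rewrite (lin_bvec p l1) scaler_sumr; apply: eq_bigr => i _.
have l2 : lin (fun q => tens (e_ i ** e_ s) (q ** e_ t)).
  exact: (lin_comp (lin_tensr _) (@lin_mulHl _ _ H _)).
rewrite (lin_bvec q l2) !scaler_sumr; apply: eq_bigr => j _.
rewrite !mulH_bvec !scalerA; congr (_ *: _).
by rewrite !mxE big_ord1 !mxE mulrC mulrA.
Qed.

Lemma tens_mul_tr x y f : tens x y *m f^T = ev f y *: x^T.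
Proof.
rewrite /tens -mulmxA; have -> : y *m f^T = (ev f y)%:M.
  apply/matrixP => i j; rewrite !ord1 !mxE eqxx mulr1n; apply: eq_bigr => s _.
  by rewrite mxE mulrC.
by rewrite mul_mx_scalar.
Qed.

Lemma sw_tens_mul_tr x (F G : V -> V) f :
  sw x (fun a b => tens (F a) (G b)) *m f^T = (sw x (fun a b => ev f (G b) *: F a))^T.
Proof.
rewrite (@lin_app_sw _ _ H _ _ (fun M : 'M[C]_n => M *m f^T)); last first.
  by move=> c A B; rewrite mulmxDl -scalemxAl.
rewrite (@lin_app_sw _ _ H _ _ (fun y : V => y^T)); last by move=> c A B; rewrite linearP.
by apply: eq_sw => i j; rewrite tens_mul_tr linearZ.
Qed.

(** The second leg is tested on functionals h(S(x0) y), which exhaust the dual, with x = S(z). The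
    left side contains S(x0) S(z) = S(z x0) and becomes the k^-1 twist of z x0; the right side is
    the product of the twists of z and x0. *)
Lemma Omega_transfer x :
  mul2 (wmul H) (tens one x) (Delta H Omega)
  = mul2 (wmul H) (tens (x *m Tmx) one) (Delta H Omega).
Proof.
rewrite !mul2_tens_Delta; apply: mulmx_trmx_inj => f; rewrite !sw_tens_mul_tr.
congr (_^T); have [h hP] := psi_surjective irrH (fun a => gdim a *: bv a).
have [x0 <-] := hdual_onto hP f; have [z <-] := antipode_onto x.
transitivity (hit H kinv (z ** x0)).
  rewrite -(hit_hdual hP); apply: eq_sw => i j.
  by rewrite (mul1H whaH) !ev_hdual (antipode_mul whaH) mulHA.
rewrite hit_kinv_mul -Tmx_antipode -(hit_hdual hP x0) /hit (lin_app_sw linr).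
by apply: eq_sw => i j; rewrite (mul1H whaH) (linZ linr).
Qed.

Lemma mx_form_inj (A B : 'M[C]_n) :
  (forall f f' : V, (f *m A *m f'^T) 0 0 = (f *m B *m f'^T) 0 0) -> A = B.
Proof.
move=> AB; apply/matrixP => i j; have := AB (e_ i) (e_ j).
by rewrite /bvec trmx_delta -!colE -!rowE !mxE.
Qed.

(** The transpose of T is F(f) = S(f) k. Inserting k k^-1 in S(f') S(f) k gives F(ff') = F(f') k^-1
    F(f), which is the claim in dual form; the reversal of legs is that of S. *)
Lemma Delta_Tmx x : Delta H (x *m Tmx) =
  \sum_a \sum_b \sum_c (Delta2 H x a b c * ev kinv (e_ b))
    *: tens (e_ c *m Tmx) (e_ a *m Tmx).
Proof.
have -> : \sum_a \sum_b \sum_c (Delta2 H x a b c * ev kinv (e_ b))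
    *: tens (e_ c *m Tmx) (e_ a *m Tmx)
  = sw x (fun p c => sw p (fun a b => ev kinv b *: tens (c *m Tmx) (a *m Tmx))).
  rewrite (sw_Delta2 H x (fun a b c => ev kinv b *: tens (c *m Tmx) (a *m Tmx))).
  by do 3!apply: eq_bigr => ? _; rewrite scalerA.
apply: mx_form_inj => f f'.
have lf : lin (fun M : 'M[C]_n => (f *m M *m f'^T) 0 0 : C^o).
  by move=> c A B; rewrite mulmxDr mulmxDl -scalemxAr -scalemxAl !mxE.
transitivity (ev (dmulH H f f') (x *m Tmx)).
  rewrite -ev_Delta mxE exchange_big; apply: eq_bigr => j _ /=.
  by rewrite !mxE mulr_suml.
pose F f := dmulH H (dS H f) k; have [kk k'k _ _] := k_gl.
transitivity (ev (dmulH H (dmulH H (F f') kinv) (F f)) x).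
  rewrite ev_Tmx dS_mul /F; congr (ev _ _).
  by rewrite !(dmulHA whaH) -(dmulHA whaH k) kk (dmul1H whaH).
rewrite ev_dmulH (lin_app_sw lf); apply: (@eq_sw _ _ _ C^o) => p c.
rewrite ev_dmulH (lin_app_sw lf).
rewrite (@lin_app_sw _ _ H _ _ (fun z : C^o => z * ev (F f) (e_ c) : C^o)); last first.
  by move=> s y z; rewrite /GRing.scale /=; ring.
apply: (@eq_sw _ _ _ C^o) => a b; rewrite (linZ lf) -mulmxA tens_mul_tr -scalemxAr.
rewrite mxE (_ : (f *m _) 0 0 = ev f (e_ c *m Tmx)); last first.
  by rewrite mxE; apply: eq_bigr => i _; rewrite mxE.
by rewrite !ev_Tmx /GRing.scale /= -/(F f) -/(F f'); ring.
Qed.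

End Dimensions.
End Fusion.

Theorem theorem5p13 (C : numClosedFieldType) (n : nat) (H : wha C n)
  (I : finType) (m : I -> nat) (psi : forall a : I, 'rV[C]_n -> 'M[C]_(m a))
  (N : I -> I -> I -> nat)
  (Vt : forall a b c, 'I_(N a b c) -> 'M[C]_(m a * m b, m c))
  (Wt : forall a b c, 'I_(N a b c) -> 'M[C]_(m c, m a * m b))
  (bv : forall a, 'M[C]_(m a)) (u : forall a, 'rV[C]_(m a))
  (v : forall a, 'cV[C]_(m a)) (l r : I -> I)
  (bar : I -> I) (hbar : forall a, bar (bar a) = a)
  (Z : forall a, 'M[C]_(m a, m (bar a))) (Zi : forall a, 'M[C]_(m (bar a), m a))
  (theta : forall c, 'cV[C]_(m (bar c) * m c))
  (w d : I -> C) (g k kinv : 'rV[C]_n) (xi : I -> C) (Omega : 'rV[C]_n) :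
  is_wha H ->
  semisimple (dmul H) ->
  irrep_family H psi ->
  fusion H psi Vt Wt ->
  vacuum H psi N bv u v l r ->
  conjugation H psi Z Zi ->
  (forall c, theta_prop hbar Zi (theta c)) ->
  (forall c, w c != 0 /\
     forall mu : 'I_(N (bar c) c (r c)),
       theta c *m zeta Z c
       = w c *: ((Vt _ _ _ mu *m v (r c)) *m (u (r c) *m Wt _ _ _ mu))) ->
  (forall a, d a ^+ 2 = w a * w (bar a) /\ d a = d (bar a)) ->
  (forall a, psi a g = (d a / w (bar a)) *:
       castmx (erefl (m a), congr1 m (hbar a)) ((Zi a)^T *m Z (bar a))) ->
  dual_pivotal H k kinv ->
  (forall a, psi a k = xi a *: psi a g) ->
  (forall f, ev f Omega =
     \sum_a (1 / (\sum_(x | l x == l a) d x ^+ 2)) * (d a / xi a)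
              * \tr (psi a f)) ->
  [/\ (* non-degenerate *)
      (forall y : 'rV[C]_n, exists f : 'rV[C]_n, f *m Delta H Omega = y),
      (forall y : 'rV[C]_n, exists f : 'rV[C]_n, (Delta H Omega *m f^T)^T = y),
      (* cocommutative *)
      (Delta H Omega)^T = Delta H Omega,
      (* idempotent *)
      mulH H Omega Omega = Omega &
      exists T : 'M[C]_n,
        forall x : 'rV[C]_n,
          mul2 (wmul H) (tens (wone H) x) (Delta H Omega)
            = mul2 (wmul H) (tens (x *m T) (wone H)) (Delta H Omega)
       /\ Delta H (x *m T)
            = \sum_a \sum_b \sum_c (Delta2 H x a b c * ev kinv (bvec b))
                 *: tens (bvec c *m T) (bvec a *m T)].
Proof.
move=> whaH ssH irrH fusH vacH conjH thetaH wH dH gH kH xiH OmegaH.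
have DU : Delta H Omega \in unitmx by eapply Delta_Omega_unit; eassumption.
have Dsym : (Delta H Omega)^T = Delta H Omega by eapply Delta_Omega_sym; eassumption.
have onto y : exists f : 'rV[C]_n, f *m Delta H Omega = y.
  by exists (y *m invmx (Delta H Omega)); rewrite mulmxKV.
split=> // [y||].
- by have [f <-] := onto y; exists f; rewrite trmx_mul trmxK Dsym.
- by eapply Omega_idem; eassumption.
exists (Tmx H k) => x; split.
  by eapply Omega_transfer; eassumption.
by eapply Delta_Tmx; eassumption.
Qed.
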